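(* For every integer $k\ge 1$ there is a constant $\delta_k>0$ depending only on $k$ such that the following holds. Let $X$ be a GNPC space, $x\in X$, and let $f$ be a $(k,\delta)$-strainer map at $x$, where $0<\delta<\delta_k$. Then there exists an arbitrarily small contractible open neighborhood $V$ of $x$ (i.e. every neighborhood of $x$ contains such a $V$) such that $f|_V:V\to f(V)$ is a Hurewicz fibration with contractible fibers.
   Context: A shortest path is an isometric embedding of a closed interval into a metric space. A complete geodesic space $(Y,d)$ is BNPC if for any two constant-speed reparametrized shortest paths $\gamma,\eta:[0,1]\to Y$, the function $t\mapsto d(\gamma(t),\eta(t))$ is convex on $[0,1]$. A metric space is locally BNPC if every point has a neighborhood that is BNPC with respect to the ambient metric. A geodesic is a curve whose restriction to each sufficiently small subinterval is a shortest path; a space is locally geodesically complete if every geodesic $\gamma:[a,b]\to X$ extends to a geodesic on $[a-\varepsilon,b+\varepsilon]$ for some $\varepsilon>0$. A GNPC space is a separable, locally compact, locally geodesically complete, locally BNPC metric space. A tiny ball in a GNPC space is an open metric ball $B$ of some radius $r$ such that the concentric closed ball of radius $10r$ is a compact BNPC space; shortest paths between points of $B$ are unique. Write $|ab|=d(a,b)$. Let $B$ be a tiny ball, $p\in B$, $q\in B\setminus\{p\}$, $x\in B\setminus\{q\}$, and let $x(t)$ be the unit-speed shortest path from $q$ to $x$. The angle viewed from $p$ at $q$ toward $x$ is $\angle pqx:=\lim_{t\to0}\tilde\angle pqx(t)$, where $\tilde\angle pqx(t)$ is the angle, at the vertex corresponding to $q$, of the Euclidean triangle with side lengths $|pq|$,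 $|px(t)|$, $|qx(t)|$ (the limit exists and $\cos\angle pqx=-\frac{d}{dt}\big|_{t=0^+}d(p,x(t))$). A point $p\in B$ is a $(1,\delta)$-strainer at $x\in B$ if there are $\bar p\in B$ (an opposite strainer for $p$ at $x$) and a neighborhood $U\subset B$ of $x$ with $p,\bar p\notin U$ such that $\angle py\bar p>\pi-\delta$ for all $y\in U$. Inductively, for $k\ge2$, $p_1,\dots,p_k\in B$ is a $(k,\delta)$-strainer at $x\in B$ if (1) $p_1,\dots,p_{k-1}$ is a $(k-1,\delta)$-strainer at $x$; (2) $p_k$ is a $(1,\delta)$-strainer at $x$; (3) there are an opposite strainer $\bar p_k$ for $p_k$ at $x$ and a neighborhood $U\subset B$ of $x$, not containing $p_1,\dots,p_k,\bar p_k$, such that $|\angle p_iyp_k-\pi/2|<\delta$ and $|\angle p_iy\bar p_k-\pi/2|<\delta$ for all $y\in U$ and $1\le i\le k-1$. A $(k,\delta)$-strainer map at $x$ is a map $f=(d(p_1,\cdot),\dots,d(p_k,\cdot))$ where, for some tiny ball $B\ni x$, $p_1,\dots,p_k\in B$ is a $(k,\delta)$-strainer at $x$. A Hurewicz fibration is a surjective continuous map with the homotopy lifting property with respect to all topological spaces. *)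

(* Defs.v *)
From HB Require Import structures.
From mathcomp Require Import all_boot all_order all_algebra.
From mathcomp Require Import all_classical all_reals all_analysis.

Set Implicit Arguments.
Unset Strict Implicit.
Unset Printing Implicit Defensive.

Import Order.TTheory GRing.Theory Num.Theory.
Import numFieldNormedType.Exports.

Local Open Scope classical_set_scope.
Local Open Scope ring_scope.

(* A curve defined on [a, b] is represented by a function on the whole of R of
   which only the values on [a, b] matter, and a subspace of X (with the ambient
   metric) by a subset A of X. *)

Section metric_geometry.
Context {R : realType} {X : metricType R}.
Implicit Types (A B U : set X) (g : R -> X) (c p q x y : X) (a b r delta : R).

(* The interval may be degenerate: constant paths are shortest paths. *)
Definition shortest_path a b g : Prop :=
  a <= b /\
  {in `[a, b] &, forall s t, mdist (g s) (g t) = `|s - t|}.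

Definition shortest_path_from_to q x g : Prop :=
  [/\ shortest_path 0 (mdist q x) g, g 0 = q & g (mdist q x) = x].

Definition constant_speed_shortest_path g : Prop :=
  exists a b (s : R -> X), shortest_path a b s /\
    {in `[0, 1], forall t, g t = s (a + t * (b - a))}.

Definition complete_set A : Prop :=
  forall F : set_system X, ProperFilter F -> F A -> cauchy F ->
    exists2 l, A l & F --> l.

Definition geodesic_set A : Prop :=
  forall x y, A x -> A y ->
    exists a b g, [/\ shortest_path a b g, g a = x, g b = y &
      {in `[a, b], forall t, A (g t)}].

Definition BNPC A : Prop :=
  [/\ complete_set A,
      geodesic_set A &
      forall g h : R -> X,
        constant_speed_shortest_path g -> constant_speed_shortest_path h ->
        {in `[0, 1], forall t, A (g t)} -> {in `[0, 1], forall t, A (h t)} ->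
        convex_function (E := R^o) `[0, 1]%classic
          (fun t : R => mdist (g t) (h t))].

Definition geodesic a b g : Prop :=
  exists2 e : R, 0 < e &
    forall s t, a <= s -> s <= t -> t <= b -> t - s < e -> shortest_path s t g.

Definition tiny_ball B : Prop :=
  exists c r, [/\ 0 < r, B = ball c r,
    compact [set y | mdist c y <= 10 * r] &
    BNPC [set y | mdist c y <= 10 * r]].

(* Law of cosines: the angle at the vertex corresponding to q of the Euclidean
   triangle with side lengths |pq|, |px| and |qx|. *)
Definition comparison_angle p q x : R :=
  acos ((mdist p q ^+ 2 + mdist q x ^+ 2 - mdist p x ^+ 2) /
        (2 * mdist p q * mdist q x)).

(* Some unit-speed shortest path from q to x (the constant path if there is
   none); it is unique on [0, |qx|] when q and x lie in a tiny ball. *)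
Definition shortest q x : R -> X :=
  xget (cst q) [set g | shortest_path_from_to q x g].

Definition angle p q x : R :=
  lim (comparison_angle p q (shortest q x t) @[t --> 0^'+]).

Definition opposite_strainer B delta p x (pbar : X) : Prop :=
  B pbar /\
  exists U, [/\ nbhs x U, U `<=` B, ~ U p, ~ U pbar &
    forall y, U y -> pi - delta < angle p y pbar].

Definition strainer1 B delta p x : Prop :=
  B p /\ exists pbar, opposite_strainer B delta p x pbar.

(* (j+1, delta)-strainers; the last point, ps ord_max, plays the role of p_k. *)
Fixpoint strainerS B delta x (j : nat) : ('I_j.+1 -> X) -> Prop :=
  match j return ('I_j.+1 -> X) -> Prop with
  | 0 => fun ps => strainer1 B delta (ps ord0) x
  | i.+1 => fun ps =>
    let qs := fun l : 'I_i.+1 => ps (widen_ord (leqnSn i.+1) l) in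
    let pk := ps ord_max in
    [/\ strainerS B delta x qs,
        strainer1 B delta pk x &
        exists (pkbar : X) U,
          [/\ opposite_strainer B delta pk x pkbar,
              nbhs x U, U `<=` B,
              (forall l, ~ U (ps l)) /\ ~ U pkbar &
              forall y (l : 'I_i.+1), U y ->
                `|angle (qs l) y pk - pi / 2| < delta /\
                `|angle (qs l) y pkbar - pi / 2| < delta]]
  end.

Definition strainer B delta x (k : nat) : ('I_k -> X) -> Prop :=
  match k return ('I_k -> X) -> Prop with
  | 0 => fun=> False
  | j.+1 => @strainerS B delta x j
  end.

Definition strainer_map (k : nat) delta x (f : X -> 'rV[R]_k) : Prop :=
  exists B (ps : 'I_k -> X),
    [/\ tiny_ball B, B x, strainer B delta x ps &
        f = (fun y => \row_i mdist (ps i) y)].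

End metric_geometry.

Section GNPC.
Context {R : realType} (X : metricType R).

Definition separable : Prop := exists2 D : set X, countable D & dense D.

Definition locally_BNPC : Prop :=
  forall x : X, exists2 U : set X, nbhs x U & BNPC U.

(* Only nondegenerate geodesics are required to extend, so that isolated points
   are allowed. *)
Definition locally_geodesically_complete : Prop :=
  forall (a b : R) (g : R -> X), a < b -> geodesic a b g ->
    exists2 e : R, 0 < e & exists2 h : R -> X,
      geodesic (a - e) (b + e) h & {in `[a, b], h =1 g}.

Definition GNPC : Prop :=
  [/\ separable, locally_compact [set: X], locally_geodesically_complete &
      locally_BNPC].

End GNPC.

Section homotopy.
Context (R : realType).

(* Contractibility of A with the subspace topology. *)
Definition contractible (T : topologicalType) (A : set T) : Prop :=
  exists (a : T) (H : T * R -> T),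
    [/\ A a,
        {within A `*` `[0, 1]%classic, continuous H},
        {in A & `[0, 1], forall z t, A (H (z, t))},
        {in A, forall z, H (z, 0) = z} &
        {in A, forall z, H (z, 1) = a}].

(* The map f, restricted to A and corestricted to C, has the homotopy lifting
   property with respect to Z. *)
Definition homotopy_lifting (T S : topologicalType) (f : T -> S)
    (A : set T) (C : set S) (Z : topologicalType) : Prop :=
  forall (H : Z * R -> S) (h : Z -> T),
    {within [set: Z] `*` `[0, 1]%classic, continuous H} ->
    (forall z, {in `[0, 1], forall t, C (H (z, t))}) ->
    continuous h -> (forall z, A (h z)) ->
    (forall z, f (h z) = H (z, 0)) ->
    exists G : Z * R -> T,
      [/\ {within [set: Z] `*` `[0, 1]%classic, continuous G},
          forall z, {in `[0, 1], forall t, A (G (z, t))},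
          forall z, G (z, 0) = h z &
          forall z, {in `[0, 1], forall t, f (G (z, t)) = H (z, t)}].

Definition hurewicz_fibration (T S : topologicalType) (f : T -> S)
    (A : set T) (C : set S) : Prop :=
  [/\ {within A, continuous f}, f @` A = C &
      forall Z : topologicalType, homotopy_lifting f A C Z].

End homotopy.

(* Main.v *)
Require Import Defs.
From mathcomp Require Import all_boot all_order all_algebra.
From mathcomp Require Import ring lra.
From mathcomp Require Import all_classical all_reals all_analysis.
Import Order.TTheory GRing.Theory Num.Theory.
Import numFieldNormedType.Exports.
Local Open Scope classical_set_scope.
Local Open Scope ring_scope.

(** Write f for the strainer map and f_i for its coordinates, the distances to
the strainer points p_i. The theorem reduces to finding a small contractible open
neighbourhood V of x with a continuous map Phi' that sends a point y of V and a
value v in f(V) to a point of V over v, and y itself if f(y) = v already.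
Homotopies of values are then lifted by composing them with Phi', and a
contraction of V followed by Phi' toward a fixed value contracts the fibre over
that value (fibration_of_retractions).

Without the constraint of staying in V, such a map comes from the strainer. From
any point near x, f_i decreases at unit speed along the geodesic to p_i and, as
the angle between p_i and its opposite point is almost pi, increases at almost
unit speed along the geodesic to that opposite point. The almost right angles say
that both motions hardly change the preceding coordinates (strainer_moves); the
following ones may change at any rate up to 1. This triangular system is
solved one coordinate after the other: move in the direction of the new
coordinate, repair the preceding ones, and repeat. The errors decay geometrically
as soon as delta is small compared with 4^-k, where 4^k bounds the cost of the
repair (correction_step, corrections). This produces Phi with f(Phi(y, v)) = v and
d(y, Phi(y, v)) <= C max_i |v_i - f_i(y)|. The link between the angles, which are
limits of comparison angles, and rates of change is the first variation formula
(first_variation): the cosine of the angle is minus the one-sided derivative of a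
distance function along a geodesic, and this derivative bounds the difference
quotients since the distance is convex.

The remaining task is to push points toward x within a fibre. A geodesic that
joins two points of one fibre may leave the fibre at a definite rate, however
small delta is: in a normed plane whose unit sphere has a corner, a distance
function looks like a maximum of two linear ones. Geodesics that end at x
itself are better. By geodesic completeness and compactness, all points near x lie
on geodesics that start at x and have a fixed length (geodesic_extension), and
along these the difference quotients of distance functions converge uniformly at x
(slope_uniform). So, at small scales, f is almost affine along the geodesics to x
(dist_almost_affine). Therefore y, moved along its geodesic to x and corrected by
Phi, comes closer to x, except when its distance to x is comparable with the
variation of f. The set V = (d(x, y) < r and |f_i(y) - f_i(x)| < eta for all i),
with eta much smaller than r, is adapted to this: moving all the way to x while the
value of f is moved linearly to f(x) contracts V, and moving slightly toward x, by an
amount proportional to the discrepancy between f(y) and v, before correcting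
by Phi keeps Phi' inside V (fibred_neighbourhood). *)

(** * Constant-speed shortest paths *)

Section constant_speed_paths.
Context {R : realType} {X : metricType R}.
Implicit Types (A : set X) (g h : R -> X) (a b p x y z : X) (s t u L : R).

Lemma mdist_lip p x y : `|mdist p x - mdist p y| <= mdist x y.
Proof.
have := metric_triangle p x y; have := metric_triangle p y x.
rewrite (metric_sym y x) => h1 h2; rewrite ler_norml; apply/andP; split; lra.
Qed.

Lemma cvg_mdist {T : Type} {F : set_system T} {FF : Filter F} (f : T -> X) p y :
  f @ F --> y -> mdist p (f u) @[u --> F] --> mdist p y.
Proof.
move=> fy; apply/cvgrPdist_le => e e0.
apply: filterS (metricType_numDomainType.cvgr_dist_le fy e0) => u h.
by apply: le_trans (mdist_lip _ _ _) h.
Qed.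

Definition const_speed a b g := [/\ g 0 = a, g 1 = b &
  forall s t, 0 <= s <= 1 -> 0 <= t <= 1 ->
    mdist (g s) (g t) = `|s - t| * mdist a b].

Lemma const_speed_shortest {a b g} :
  const_speed a b g -> constant_speed_shortest_path g.
Proof.
move=> [g0 g1 gd]; exists 0, (mdist a b), (fun u => g (u / mdist a b)).
have d0 := mdist_ge0 a b.
split; last first.
  move=> t; rewrite in_itv/= => t01; rewrite add0r subr0.
  have [d00|dn0] := eqVneq (mdist a b) 0; last by rewrite mulfK.
  rewrite d00 mulr0 mul0r; apply: mdist_positivity.
  by rewrite gd ?d00 ?mulr0// lexx ler01.
split => // s t; rewrite !in_itv/= => /andP[s0 sd] /andP[t0 td].
have [d00|dn0] := eqVneq (mdist a b) 0.
  have -> : s = 0 by lra.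
  have -> : t = 0 by lra.
  by rewrite mdistxx subrr normr0.
have dp : 0 < mdist a b by rewrite lt_neqAle eq_sym dn0.
rewrite gd; last 2 first.
- by rewrite divr_ge0// ler_pdivrMr// mul1r.
- by rewrite divr_ge0// ler_pdivrMr// mul1r.
by rewrite -mulrBl normrM normfV (gtr0_norm dp) mulfVK.
Qed.

Lemma const_speed_cst p : const_speed p p (cst p).
Proof. by split=> // s t _ _; rewrite mdistxx mulr0. Qed.

Lemma const_speed_sub {a b g s u} : const_speed a b g ->
  0 <= s <= 1 -> 0 <= u <= 1 ->
  const_speed (g s) (g u) (fun t => g (s + t * (u - s))).
Proof.
move=> [g0 g1 gd] s01 u01.
have I t : 0 <= t <= 1 -> 0 <= s + t * (u - s) <= 1.
  by move=> t01; apply/andP; split; nra.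
split; [by rewrite mul0r addr0|by rewrite mul1r addrC subrK|].
move=> t t' t01 t'01; rewrite !gd ?I//.
rewrite [in LHS](_ : _ - _ = (t - t') * (u - s)); last by ring.
by rewrite normrM -mulrA (distrC u s).
Qed.

Lemma shortest_const_speed {a b : R} {g} : shortest_path a b g ->
  const_speed (g a) (g b) (fun t => g (a + t * (b - a))).
Proof.
move=> [ab gd]; split; [by rewrite mul0r addr0|by rewrite mul1r addrC subrK|].
move=> s t s01 t01.
rewrite !gd ?in_itv/= ?lexx ?ab//; try by apply/andP; split; nra.
rewrite (_ : _ - _ = (s - t) * (b - a)); last by ring.
by rewrite normrM (distrC a b).
Qed.

(** A curve that is nowhere longer than its parameter and has extremities as far
apart as the parameter allows cannot waste any length in between. *)
Lemma lipschitz_shortest {L g} : 0 <= L ->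
  (forall s t, 0 <= s -> s <= t -> t <= L -> mdist (g s) (g t) <= t - s) ->
  L <= mdist (g 0) (g L) -> shortest_path 0 L g.
Proof.
move=> L0 gl gL; split => //.
have main s t : 0 <= s -> s <= t -> t <= L -> mdist (g s) (g t) = t - s.
  move=> s0 st tL; apply/eqP; rewrite eq_le gl//=.
  have := metric_triangle (g 0) (g s) (g L).
  have := metric_triangle (g s) (g t) (g L).
  have := gl 0 s (lexx _) s0 (le_trans st tL).
  have := gl t L (le_trans s0 st) tL (lexx _).
  by lra.
move=> s t; rewrite !in_itv/= => /andP[s0 sL] /andP[t0 tL].
have [st|ts] := leP s t; first by rewrite main// distrC ger0_norm// subr_ge0.
by rewrite metric_sym (main _ _ t0 (ltW ts) sL) ger0_norm// subr_ge0 ltW.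
Qed.

(** The increments of phi are nondecreasing, so phi 0 <= 0 gives
(j+1) phi j <= j phi (j+1); the sign of phi N then descends to all indices. *)
Lemma discrete_convex_le0 (phi : nat -> R) (N : nat) :
  phi 0%N <= 0 -> phi N <= 0 ->
  (forall j, (j.+1 < N)%N -> 2 * phi j.+1 <= phi j + phi j.+2) ->
  forall j, (j <= N)%N -> phi j <= 0.
Proof.
move=> phi0 phiN conv.
have slope j : (j < N)%N -> j.+1%:R * phi j <= j%:R * phi j.+1.
  elim: j => [|j IH] jN; first by rewrite mul0r mul1r.
  have := IH (ltnW jN); have := conv _ jN; rewrite -!natr1.
  have : 0 <= j%:R :> R by [].
  set J := j%:R; move: (phi j) (phi j.+1) (phi j.+2) => p q r; nra.
move=> j jN; rewrite -(subKn jN); elim: (N - j)%N => [|i IH].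
  by rewrite subn0.
have [iN|Ni] := ltnP i N; last first.
  by have /eqP -> : (N - i.+1 == 0)%N by rewrite subn_eq0 ltnW.
have mN : (N - i.+1 < N)%N by rewrite subnSK// leq_subr.
rewrite -(pmulr_rle0 _ (ltr0Sn R (N - i.+1))).
by apply: le_trans (slope _ mN) _; rewrite subnSK//; apply: mulr_ge0_le0.
Qed.

End constant_speed_paths.

(** * Geodesics of a Busemann convex set *)

Section Busemann_convexity.
Context {R : realType} {X : metricType R} {A : set X} (hA : BNPC A).
Implicit Types (g h : R -> X) (a b p x y z : X) (s t u L e : R).

Definition stays g := forall t, 0 <= t <= 1 -> A (g t).

Lemma Busemann_le {a b c d g h t} : const_speed a b g -> const_speed c d h ->
  stays g -> stays h -> 0 <= t <= 1 ->
  mdist (g t) (h t) <= (1 - t) * mdist a c + t * mdist b d.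
Proof.
move=> cg ch gA hhA /andP[t0 t1].
have [_ _ /(_ g h (const_speed_shortest cg) (const_speed_shortest ch))] := hA.
move=> /(_ _ _)/wrap[||cvx].
- by move=> u; rewrite in_itv/=; apply: gA.
- by move=> u; rewrite in_itv/=; apply: hhA.
have t01 : Itv.spec (@Itv.num_sem R) (Itv.Real `[0%Z, 1%Z]) t.
  by rewrite /Itv.spec/= /Itv.num_sem/= num_real/= in_itv/= t0 t1.
pose p : {i01 R} := Itv.Def t01.
have m0 : (0 : R) \in `[0, 1]%classic by rewrite inE/= in_itv/= lexx ler01.
have m1 : (1 : R) \in `[0, 1]%classic by rewrite inE/= in_itv/= ler01 lexx.
have pE : conv p (1 : R^o) (0 : R^o) = t.
  by rewrite convRE/= mulr1 mulr0 addr0.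
have := cvx p 1 0 m1 m0; rewrite convRE/= [conv _ _ _]pE.
have [-> -> _] := cg; have [-> -> _] := ch; rewrite /unstable.onem.
by rewrite addrC.
Qed.

Lemma const_speed_unique {a b g h} : const_speed a b g -> const_speed a b h ->
  stays g -> stays h -> forall t, 0 <= t <= 1 -> g t = h t.
Proof.
move=> cg ch gA hhA t t01; apply: mdist_positivity; apply/eqP.
rewrite eq_le mdist_ge0 andbT.
by have := Busemann_le cg ch gA hhA t01; rewrite !mdistxx !mulr0 addr0.
Qed.

(** Parametrizing by [0, 1] whatever the length makes the distance between two
geodesics a convex function of the common parameter. *)
Definition geo a b : R -> X :=
  xget (cst a) [set g | const_speed a b g /\ stays g].

Lemma geo_spec {a b} : A a -> A b -> const_speed a b (geo a b) /\ stays (geo a b).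
Proof.
move=> Aa Ab; rewrite /geo.
case: xgetP => [g -> //|noway]; exfalso.
have [_ geoA _] := hA; have [c [d [g [sg gc gd gA]]]] := geoA _ _ Aa Ab.
have := shortest_const_speed sg; rewrite gc gd => cg; have [cd _] := sg.
apply: (noway (fun t => g (c + t * (d - c)))); split => // t t01.
by apply: gA; rewrite in_itv/=; apply/andP; split; nra.
Qed.

Lemma geoA {a b t} : A a -> A b -> 0 <= t <= 1 -> A (geo a b t).
Proof. by move=> Aa Ab; have [_] := geo_spec Aa Ab; apply. Qed.

Lemma geo0 {a b} : A a -> A b -> geo a b 0 = a.
Proof. by move=> Aa Ab; have [[]] := geo_spec Aa Ab. Qed.

Lemma geo1 {a b} : A a -> A b -> geo a b 1 = b.
Proof. by move=> Aa Ab; have [[]] := geo_spec Aa Ab. Qed.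

Lemma geo_dist {a b s t} : A a -> A b -> 0 <= s <= 1 -> 0 <= t <= 1 ->
  mdist (geo a b s) (geo a b t) = `|s - t| * mdist a b.
Proof. by move=> Aa Ab; have [[_ _ h] _] := geo_spec Aa Ab; apply: h. Qed.

Lemma geo_distl {a b t} : A a -> A b -> 0 <= t <= 1 ->
  mdist a (geo a b t) = t * mdist a b.
Proof.
move=> Aa Ab t01; rewrite -{1}(geo0 Aa Ab) geo_dist// ?lexx ?ler01//.
by rewrite sub0r normrN ger0_norm//; case/andP: t01.
Qed.

Lemma geo_distr {a b t} : A a -> A b -> 0 <= t <= 1 ->
  mdist (geo a b t) b = (1 - t) * mdist a b.
Proof.
move=> Aa Ab t01; rewrite -{2}(geo1 Aa Ab) geo_dist// ?lexx ?ler01//.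
by rewrite distrC ger0_norm// subr_ge0; case/andP: t01.
Qed.

Lemma geo_unique {a b g} : const_speed a b g -> stays g ->
  forall t, 0 <= t <= 1 -> g t = geo a b t.
Proof.
move=> cg gA t t01.
have Aa : A a by have [<- _ _] := cg; apply: gA; rewrite lexx ler01.
have Ab : A b by have [_ <- _] := cg; apply: gA; rewrite lexx ler01.
have [cgeo geoA] := geo_spec Aa Ab.
exact: const_speed_unique cg cgeo gA geoA _ t01.
Qed.

(** The case u < s reverses the geodesic. *)
Lemma geo_geo {a b s u t} : A a -> A b ->
  0 <= s <= 1 -> 0 <= u <= 1 -> 0 <= t <= 1 ->
  geo (geo a b s) (geo a b u) t = geo a b (s + t * (u - s)).
Proof.
move=> Aa Ab s01 u01 t01; have [cg gA] := geo_spec Aa Ab.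
rewrite -(geo_unique (const_speed_sub cg s01 u01))// => v v01.
by apply: gA; apply/andP; split; nra.
Qed.

Lemma geo_conv {a b c d t} : A a -> A b -> A c -> A d -> 0 <= t <= 1 ->
  mdist (geo a b t) (geo c d t) <= (1 - t) * mdist a c + t * mdist b d.
Proof.
move=> Aa Ab Ac Ad; have [? ?] := geo_spec Aa Ab; have [? ?] := geo_spec Ac Ad.
exact: Busemann_le.
Qed.

Lemma dist_geo_conv {p a b t} : A p -> A a -> A b -> 0 <= t <= 1 ->
  mdist p (geo a b t) <= (1 - t) * mdist p a + t * mdist p b.
Proof.
move=> Ap Aa Ab; have [cg gA] := geo_spec Aa Ab.
by apply: (Busemann_le (const_speed_cst p) cg _ gA) => ? _.
Qed.

Lemma dist_geo_conv_param {p a b s u t} : A p -> A a -> A b ->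
  0 <= s <= 1 -> 0 <= u <= 1 -> 0 <= t <= 1 ->
  mdist p (geo a b (s + t * (u - s))) <=
    (1 - t) * mdist p (geo a b s) + t * mdist p (geo a b u).
Proof.
move=> Ap Aa Ab s01 u01 t01; rewrite -geo_geo//.
by apply: dist_geo_conv => //; apply: geoA.
Qed.

Lemma geo_lip {a b c d s t} : A a -> A b -> A c -> A d ->
  0 <= s <= 1 -> 0 <= t <= 1 ->
  mdist (geo a b s) (geo c d t) <=
    mdist a c + mdist b d + `|s - t| * mdist c d.
Proof.
move=> Aa Ab Ac Ad s01 t01.
have := metric_triangle (geo a b s) (geo c d s) (geo c d t).
rewrite (geo_dist Ac Ad s01 t01) => /le_trans; apply.
rewrite lerD2r; apply: le_trans (geo_conv Aa Ab Ac Ad s01) _.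
have := mdist_ge0 a c; have := mdist_ge0 b d; move/andP: s01 => [].
by move: (mdist a c) (mdist b d) => p q s0 s1 q0 p0; nra.
Qed.

Lemma cvg_geo {T : Type} {F : set_system T} {FF : Filter F}
    {Y : T -> X} {S : T -> R} {b y s} :
  A b -> A y -> 0 <= s <= 1 -> Y @ F --> y -> S @ F --> s ->
  (\forall v \near F, A (Y v) /\ 0 <= S v <= 1) ->
  geo (Y v) b (S v) @[v --> F] --> geo y b s.
Proof.
move=> Ab Ay s01 Yy Ss nearA.
pose err v := mdist y (Y v) + `|s - S v| * mdist b (Y v).
have err0 : err v @[v --> F] --> 0.
  rewrite -[0](_ : mdist y y + `|s - s| * mdist b y = 0); last first.
    by rewrite subrr normr0 mul0r mdistxx addr0.
  apply: cvgD; first exact: cvg_mdist.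
  apply: cvgM; last exact: cvg_mdist.
  by apply: cvg_norm; apply: cvgB => //; exact: cvg_cst.
apply/metricType_numDomainType.cvgrPdist_lt => e e0; near=> v.
have [AY S01] : A (Y v) /\ 0 <= S v <= 1 by near: v.
apply: (@le_lt_trans _ _ (err v)).
  by apply: le_trans (geo_lip Ay Ab AY Ab s01 S01) _; rewrite mdistxx addr0 /err (metric_sym b).
near: v; exact: (cvgr_lt _ err0 _ e0).
Unshelve. all: by end_near. Qed.

(** The path entering the definition of angles is a shortest path of the whole
space. It stays in the ball about y through z; when this ball lies in A,
uniqueness of geodesics in A identifies it. *)
Lemma shortest_geo {y z t} : y != z -> A y ->
  (forall w, mdist y w <= mdist y z -> A w) -> 0 <= t <= mdist y z ->
  shortest y z t = geo y z (t / mdist y z).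
Proof.
move=> yz Ay near t0L; have L0 : 0 < mdist y z by rewrite mdist_gt0.
have Az : A z by apply: near.
have from_to g : shortest_path_from_to y z g ->
    const_speed y z (fun v => g (v * mdist y z)) /\
    stays (fun v => g (v * mdist y z)).
  move=> [sg g0 gL]; have := shortest_const_speed sg; rewrite g0 gL.
  under eq_fun do rewrite add0r subr0.
  move=> cg; split => // v v01; apply: near.
  have [e0 _ /(_ 0 v)] := cg; rewrite e0 => ->//; rewrite ?lexx ?ler01//.
  rewrite sub0r normrN ger0_norm; last by case/andP: v01.
  by rewrite ger_pMl//; case/andP: v01.
have tL : 0 <= t / mdist y z <= 1.
  by case/andP: t0L => t0 tL; rewrite divr_ge0 ?(ltW L0)//= ler_pdivrMr// mul1r.
rewrite /shortest; case: xgetP => [g -> /from_to[cg gA]|noway].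
  by rewrite -(geo_unique cg gA _ tL) mulfVK// gt_eqF.
exfalso; apply: (noway (fun v => geo y z (v / mdist y z))).
have [cg gA] := geo_spec Ay Az.
split; last 2 first.
- by rewrite mul0r geo0.
- by rewrite divff ?gt_eqF// geo1.
split; first exact: ltW.
move=> u v; rewrite !in_itv/= => /andP[u0 u1] /andP[v0 v1].
rewrite geo_dist//; last 2 first.
- by rewrite divr_ge0 ?(ltW L0)//= ler_pdivrMr// mul1r.
- by rewrite divr_ge0 ?(ltW L0)//= ler_pdivrMr// mul1r.
by rewrite -mulrBl normrM normfV (gtr0_norm L0) mulfVK// gt_eqF.
Qed.

(** Two shortest paths whose lengths add up to the distance of their far ends
concatenate to a shortest path, which by uniqueness is the geodesic. *)
Lemma geo_through {x y z} : A x -> A y -> A z -> x != z ->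
  mdist x y + mdist y z = mdist x z -> geo x z (mdist x y / mdist x z) = y.
Proof.
move=> Ax Ay Az xz xyz; have L0 : 0 < mdist x z by rewrite mdist_gt0.
set T := mdist x y; set L := mdist x z in L0 *.
have T0 : 0 <= T := mdist_ge0 _ _.
have TL : T <= L by rewrite -[L]xyz lerDl mdist_ge0.
have [Ty0|Ty0] := eqVneq T 0.
  by rewrite Ty0 mul0r geo0//; apply/mdist_positivity.
have [TyL|TyL] := eqVneq T L.
  rewrite TyL divff ?gt_eqF// geo1//; apply/esym/mdist_positivity.
  by move: xyz; rewrite -/T -/L TyL => h; lra.
have Tp : 0 < T by rewrite lt_neqAle eq_sym Ty0.
have TLp : T < L by rewrite lt_neqAle TyL.
pose g u := if u <= T then geo x y (u / T) else geo y z ((u - T) / (L - T)).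
have yzE : mdist y z = L - T by rewrite -[L]xyz addrAC subrr add0r.
have i1 u : 0 <= u -> u <= T -> 0 <= u / T <= 1.
  by move=> u0 uT; rewrite divr_ge0//= ler_pdivrMr// mul1r.
have i2 u : T <= u -> u <= L -> 0 <= (u - T) / (L - T) <= 1.
  move=> u0 uT; rewrite divr_ge0 ?subr_ge0//= ler_pdivrMr ?subr_gt0// mul1r.
  by rewrite lerD2r.
have gl s t : 0 <= s -> s <= t -> t <= L -> mdist (g s) (g t) <= t - s.
  move=> s0 st tL; rewrite /g; case: (leP s T) => sT; case: (leP t T) => tT.
  - rewrite geo_dist// ?i1//; last exact: le_trans st.
    rewrite -mulrBl normrM normfV (gtr0_norm Tp) mulfVK ?gt_eqF//.
    by rewrite distrC ger0_norm// subr_ge0.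
  - apply: le_trans (metric_triangle _ y _) _.
    rewrite geo_distr// ?i1// geo_distl// ?i2// ?(ltW tT)// -/T yzE.
    rewrite mulfVK ?mulrBl ?mul1r ?mulfVK ?gt_eqF ?subr_gt0//.
    by rewrite addrC addrA subrK.
  - by move: (lt_le_trans sT st); rewrite ltNge tT.
  - rewrite geo_dist// ?i2// ?(ltW sT) ?(ltW tT)//; last exact: le_trans tL.
    rewrite yzE -mulrBl normrM normfV (@gtr0_norm _ (L - T)) ?subr_gt0//.
    rewrite mulfVK ?gt_eqF ?subr_gt0// distrC ger0_norm; lra.
have g0 : g 0 = x by rewrite /g T0 mul0r geo0.
have gL : g L = z.
  by rewrite /g leNgt TLp/= divff ?gt_eqF ?subr_gt0// geo1.
have sg : shortest_path 0 L g.
  by apply: lipschitz_shortest => //; [exact: ltW|rewrite g0 gL].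
have := shortest_const_speed sg; rewrite g0 gL.
under eq_fun do rewrite add0r subr0.
move=> cg; rewrite -(geo_unique cg).
- by rewrite mulfVK ?gt_eqF// /g lexx divff// geo1.
- move=> u u01; rewrite /g.
  have u0 : 0 <= u * L by apply: mulr_ge0; [case/andP: u01|exact: ltW].
  have uL : u * L <= L by rewrite ger_pMl//; case/andP: u01.
  by case: leP => uT; apply: geoA => //; [apply: i1|apply: i2 => //; exact: ltW].
- by rewrite divr_ge0 ?(ltW L0)//= ler_pdivrMr// mul1r.
Qed.

End Busemann_convexity.
Arguments geo {R X} A a b t.

(** * Extension of geodesics *)

Section geodesics_in_Busemann_sets.
Context {R : realType} {X : metricType R} {A : set X} (hA : BNPC A).
Implicit Types (g : R -> X) (p x y z : X) (s t u L e r : R).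

Lemma small_fraction {L e} : 0 < L -> 0 < e ->
  exists N : nat, (0 < N)%N /\ L / N%:R < e.
Proof.
move=> L0 e0; have eL : 0 < e / L by rewrite divr_gt0.
have [N _ /(_ N (leqnn N))/= hN] := near_infty_natSinv_lt (PosNum eL).
by exists N.+1; split=> //; rewrite mulrC -ltr_pdivlMr.
Qed.

Lemma geodesic_lip {L g} : geodesic 0 L g -> forall s t,
  0 <= s -> s <= t -> t <= L -> mdist (g s) (g t) <= t - s.
Proof.
move=> [e e0 gloc] s t s0 st tL.
have [->|tns] := eqVneq t s; first by rewrite mdistxx subrr.
have ts0 : 0 < t - s by rewrite subr_gt0 lt_neqAle eq_sym tns.
have [N [N0 Ne]] := small_fraction ts0 e0.
set w := (t - s) / N%:R in Ne *; have w0 : 0 < w by rewrite divr_gt0// ltr0n.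
have Nw : N%:R * w = t - s by rewrite mulrC mulfVK// pnatr_eq0 -lt0n.
suff main j : (j <= N)%N -> mdist (g s) (g (s + j%:R * w)) <= j%:R * w.
  by have := main N (leqnn _); rewrite Nw addrC subrK.
elim: j => [|j IH] jN; first by rewrite mul0r addr0 mdistxx.
apply: le_trans (metric_triangle _ (g (s + j%:R * w)) _) _.
have jw0 : 0 <= j%:R * w by rewrite mulr_ge0// ltW.
have jE : j.+1%:R * w = j%:R * w + w by rewrite -natr1; ring.
have jwN : j.+1%:R * w <= t - s by rewrite -Nw ler_pM2r// ler_nat.
rewrite jE lerD ?IH ?(ltnW jN)//.
rewrite jE in jwN.
have [||||_ ->] := gloc (s + j%:R * w) (s + (j%:R * w + w)).
- by rewrite addr_ge0.
- lra.
- lra.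
- lra.
- rewrite (_ : _ - _ = - w); last by ring.
  by rewrite normrN gtr0_norm.
- by rewrite in_itv/=; apply/andP; split; lra.
- by rewrite in_itv/=; apply/andP; split; lra.
Qed.

(** The distance between a local geodesic and the shortest path with the same
ends is locally convex, hence convex along a fine subdivision; as it vanishes at
the ends, both curves pass through the subdivision points at the same times, and
so have the same speed. *)
Lemma geodesic_shortest {L g} : 0 < L -> geodesic 0 L g ->
  (forall t, 0 <= t <= L -> A (g t)) -> shortest_path 0 L g.
Proof.
move=> L0 geog gA; apply: (lipschitz_shortest (ltW L0) (geodesic_lip geog)).
have [e e0 gloc] := geog.
have L20 : 0 < 2 * L by rewrite mulr_gt0.
have [N [N0 Ne]] := small_fraction L20 e0.
have NR0 : 0 < N%:R :> R by rewrite ltr0n.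
set w := L / N%:R.
have w0 : 0 < w by rewrite divr_gt0.
have we : 2 * w < e by rewrite mulrA.
have Nw : N%:R * w = L by rewrite mulrC mulfVK// gt_eqF.
have jw j : (j <= N)%N -> 0 <= j%:R * w <= L.
  by move=> jN; rewrite mulr_ge0 ?(ltW w0)//= -Nw ler_pM2r// ler_nat.
have jN j : (j <= N)%N -> 0 <= (j%:R / N%:R : R) <= 1.
  by move=> jN; rewrite divr_ge0//= ler_pdivrMr// mul1r ler_nat.
have Ag0 : A (g 0) by apply: gA; rewrite lexx ltW.
have AgL : A (g L) by apply: gA; rewrite lexx ltW.
(* The curve g and the geodesic between its ends, compared at equal times. *)
pose phi j := mdist (g (j%:R * w)) (geo A (g 0) (g L) (j%:R / N%:R)).
have phi1 : phi 1%N <= 0.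
  apply: (@discrete_convex_le0 _ phi N) => //.
  - by rewrite /phi !mul0r geo0// mdistxx.
  - by rewrite /phi Nw divff ?gt_eqF// geo1// mdistxx.
  move=> j jlt; rewrite /phi.
  have half : 0 <= (1 / 2 : R) <= 1 by apply/andP; split; lra.
  have jw0 : 0 <= j%:R * w by rewrite mulr_ge0// ltW.
  have j2E : j.+2%:R * w = j%:R * w + 2 * w by rewrite -!natr1; ring.
  have j1E : j.+1%:R * w = j%:R * w + 1 / 2 * (j.+2%:R * w - j%:R * w).
    by rewrite -!natr1; field.
  have j1NE : j.+1%:R / N%:R =
      j%:R / N%:R + 1 / 2 * (j.+2%:R / N%:R - j%:R / N%:R) :> R.
    by rewrite -!natr1; field; rewrite gt_eqF.
  have /andP[_ j2L] := jw _ jlt.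
  have jle : (j <= N)%N by rewrite (leq_trans _ jlt)// ltnW.
  have sg : shortest_path (j%:R * w) (j.+2%:R * w) g.
    by apply: gloc => //; rewrite j2E; lra.
  rewrite j1NE -(geo_geo hA) ?jN//.
  rewrite [in leLHS]j1E (geo_unique hA (shortest_const_speed sg))//; last first.
    by move=> t /andP[t0 t1]; apply: gA; rewrite j2E in j2L *; apply/andP; split; nra.
  apply: le_trans (ler_wpM2l _ (geo_conv hA _ _ _ _ half)) _ => //.
  - by apply: gA; apply: jw.
  - by apply: gA; apply: jw.
  - by apply: (geoA hA) => //; exact: jN.
  - by apply: (geoA hA) => //; exact: jN.
  by set p := mdist _ _; set q := mdist _ _; lra.
have g1 : g w = geo A (g 0) (g L) (1 / N%:R).
  apply: mdist_positivity; apply/eqP; rewrite eq_le mdist_ge0 andbT.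
  by move: phi1; rewrite /phi !mul1r.
have [||||_ ww] := gloc 0 w => //.
- exact: ltW.
- by have /andP[] := jw 1%N N0; rewrite mul1r.
- by rewrite subr0; apply: le_lt_trans we; lra.
have : mdist (g 0) (g w) = w.
  by rewrite ww ?in_itv/= ?lexx ?(ltW w0)// sub0r normrN gtr0_norm.
rewrite g1 (geo_distl hA)//; last exact: (jN 1%N).
move=> dw; rewrite -[leLHS]Nw -[X in _ * X <= _]dw.
by rewrite mulrA mul1r divff ?mul1r ?gt_eqF.
Qed.

Lemma continuous_mdist p : continuous (mdist p : X -> R).
Proof. by move=> y; apply: cvg_mdist. Qed.

(** Extend a shortest path from x through y as far as possible inside the ball:
a farthest extension exists by compactness, and it ends on the sphere because a
geodesic ending before the sphere could be extended a little further and would,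
inside the convex ball, still be shortest. *)
Lemma geodesic_extension {x r} : compact A -> 0 < r ->
  (forall w, mdist x w <= r -> A w) -> locally_geodesically_complete X ->
  forall y, x != y -> mdist x y <= r ->
  exists z, mdist x z = r /\ mdist x y + mdist y z = mdist x z.
Proof.
move=> cA r0 xA ext y xy yr.
pose Z := [set z | mdist x z <= r] `&` [set z | mdist y z - mdist x z = - mdist x y].
have Zy : Z y by split => //=; rewrite mdistxx sub0r.
have cZ : compact Z.
  apply: (subclosed_compact _ cA); last by move=> z [/xA].
  apply: closedI.
  - rewrite (_ : mkset _ = mdist x @^-1` [set u | u <= r])//.
    by apply: closed_comp => [z _|]; [exact: continuous_mdist|exact: closed_le].
  - rewrite (_ : mkset _ =
      (fun z => mdist y z - mdist x z) @^-1` [set u | u = - mdist x y])//.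
    apply: closed_comp => [z _|]; last exact: closed_eq.
    by apply: cvgB; exact: continuous_mdist.
have [||z /set_mem[/= zr zy] zmax] := @compact_EVT_max _ _ (mdist x) Z _ cZ.
- by exists y.
- exact: continuous_subspaceT (@continuous_mdist x).
have xyz : mdist x y + mdist y z = mdist x z by lra.
exists z; split => //; apply/eqP; rewrite eq_le zr/= leNgt; apply/negP => zlt.
set L := mdist x z in zlt xyz zy zmax zr *; set T := mdist x y in xyz zy *.
have T0 : 0 < T by rewrite mdist_gt0.
have L0 : 0 < L by rewrite -xyz ltr_pwDl// mdist_ge0.
have xz : x != z by rewrite -mdist_gt0.
have Ax : A x by apply: xA; rewrite mdistxx ltW.
have Ay : A y by apply: xA.
have Az : A z by apply: xA.
pose g u := geo A x z (u / L).
have gT : g T = y by apply: geo_through.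
have iL u : 0 <= u -> u <= L -> 0 <= u / L <= 1.
  by move=> u0 uL; rewrite divr_ge0 ?(ltW L0)//= ler_pdivrMr// mul1r.
have gg : geodesic 0 L g.
  exists 1 => // s t s0 st tL _; split => // u v; rewrite !in_itv/=.
  move=> /andP[su ut] /andP[sv vt]; rewrite (geo_dist hA)//; last 2 first.
  - by apply: iL; [exact: le_trans su|exact: le_trans tL].
  - by apply: iL; [exact: le_trans sv|exact: le_trans tL].
  by rewrite -mulrBl normrM normfV (gtr0_norm L0) mulfVK// gt_eqF.
have [e e0 [h [d d0 hd] hg]] := ext 0 L g L0 gg.
(* The extension is used only as far as the ball reaches. *)
pose M := Num.min (L + e) r.
have LM : L < M by rewrite lt_min zlt andbT ltrDl.
have Mr : M <= r by rewrite ge_min lexx orbT.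
have M0 : 0 < M := lt_trans L0 LM.
have geoh : geodesic 0 M h.
  exists d => // s t s0 st tM; apply: hd => //.
    by apply: le_trans s0; rewrite sub0r oppr_le0 ltW.
  by apply: le_trans tM _; rewrite ge_min lexx.
have h0 : h 0 = x.
  by rewrite hg ?in_itv/= ?lexx ?(ltW L0)// /g mul0r (geo0 hA).
have hT : h T = y.
  by rewrite hg ?in_itv/= ?(ltW T0)//= -xyz lerDl mdist_ge0.
have [_ hdist] : shortest_path 0 M h.
  apply: geodesic_shortest => // t /andP[t0 tM]; apply: xA.
  rewrite -h0; apply: le_trans (geodesic_lip geoh _ _ (lexx 0) t0 tM) _.
  by rewrite subr0 (le_trans tM).
have TM : T < M by apply: le_lt_trans LM; rewrite -xyz lerDl mdist_ge0.
have ZM : Z (h M).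
  have xM : mdist x (h M) = M.
    rewrite -h0 hdist ?in_itv/= ?lexx ?(ltW M0)//.
    by rewrite sub0r normrN gtr0_norm.
  have yM : mdist y (h M) = M - T.
    rewrite -hT hdist ?in_itv/= ?lexx ?(ltW M0) ?(ltW T0) ?(ltW TM)//.
    by rewrite distrC gtr0_norm ?subr_gt0.
  by split; rewrite /= xM// yM -/T; ring.
have := zmax (h M); rewrite inE => /(_ ZM).
rewrite -{1}h0 hdist ?in_itv/= ?lexx ?(ltW M0)// sub0r normrN gtr0_norm//.
by rewrite leNgt LM.
Qed.

End geodesics_in_Busemann_sets.

(** * Distance functions at small scales *)

Section infinitesimal_homogeneity.
Context {R : realType} {X : metricType R} {A : set X} (hA : BNPC A).
Implicit Types (p x y z : X) (s t e r rho : R).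

(** A rate of change per unit of the parameter in [0, 1]: it is |xz| times the
rate per unit of length. *)
Definition slope p x z t := (mdist p (geo A x z t) - mdist p x) / t.

Lemma slope_monotone {p x z} : A p -> A x -> A z ->
  forall s t, 0 < s -> s <= t -> t <= 1 -> slope p x z s <= slope p x z t.
Proof.
move=> Ap Ax Az s t s0 st t1; have t0 := lt_le_trans s0 st.
rewrite /slope ler_pdivrMr// mulrAC ler_pdivlMr//.
have t01 : 0 <= t <= 1 by rewrite (ltW t0).
have st01 : 0 <= s / t <= 1 by rewrite divr_ge0 ?(ltW s0) ?(ltW t0)//= ler_pdivrMr// mul1r.
have := dist_geo_conv_param hA Ap Ax Az (s := 0) (u := t) _ t01 st01.
rewrite lexx ler01 => /(_ isT).
rewrite subr0 add0r mulfVK ?gt_eqF// (geo0 hA)//.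
set D := mdist p _; set D0 := mdist p x; set Dt := mdist p _ => h.
have : t * D <= t * ((1 - s / t) * D0 + s / t * Dt) by rewrite ler_pM2l.
rewrite [leRHS](_ : _ = (t - s) * D0 + s * Dt); last by field; rewrite gt_eqF.
by lra.
Qed.

Lemma slope_ge {p x z t} : A x -> A z -> 0 < t -> t <= 1 ->
  - mdist x z <= slope p x z t.
Proof.
move=> Ax Az t0 t1; rewrite /slope ler_pdivlMr//.
have := mdist_lip p (geo A x z t) x.
rewrite ler_norml => /andP[+ _]; rewrite metric_sym (geo_distl hA)//.
  by rewrite mulNr mulrC.
by rewrite ltW.
Qed.

Lemma slope_lip {p x z w t} : A x -> A z -> A w -> 0 < t -> t <= 1 ->
  `|slope p x z t - slope p x w t| <= mdist z w.
Proof.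
move=> Ax Az Aw t0 t1; rewrite /slope -mulrBl normrM normfV (gtr0_norm t0).
rewrite ler_pdivrMr// opprB addrA subrK mulrC.
apply: le_trans (mdist_lip p _ _) _.
have t01 : 0 <= t <= 1 by rewrite ltW.
by have := geo_conv hA Ax Az Ax Aw t01; rewrite mdistxx mulr0 add0r.
Qed.

(** Along every geodesic from x the slopes of the distance to p decrease to a
limit as the parameter tends to 0; being equicontinuous in the end point, they do
so uniformly over the compact sphere of radius r. *)
Lemma slope_uniform {p x r e} : compact A -> A p ->
  (forall w, mdist x w <= r -> A w) -> 0 < r -> 0 < e ->
  exists2 t0, 0 < t0 & forall z t, mdist x z = r -> 0 < t -> t < t0 ->
    2 * t <= 1 /\ slope p x z (2 * t) - slope p x z t <= e.
Proof.
move=> cA Ap xA r0 e0.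
have Ax : A x by apply: xA; rewrite mdistxx ltW.
pose S := [set z | mdist x z = r].
have SA z : S z -> A z by move=> Sz; apply: xA; rewrite Sz.
have cS : compact S.
  apply: (subclosed_compact _ cA SA).
  rewrite (_ : S = mdist x @^-1` [set u | u = r])//.
  by apply: closed_comp => [z _|]; [exact: continuous_mdist|exact: closed_eq].
pose P t z := S z -> 0 < t ->
  2 * t <= 1 /\ slope p x z (2 * t) - slope p x z t <= e.
have e4 : 0 < e / 4 by rewrite divr_gt0.
have near_z z : S z -> \forall w \near z & t \near (0 : R)^'+, P t w.
  move=> Sz; have Az := SA _ Sz.
  pose E := [set slope p x z t | t in `]0, 1]%classic].
  have lbE : has_lbound E.
    exists (- mdist x z) => _ [t + <-]; rewrite /= in_itv/= => /andP[t0 t1].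
    exact: slope_ge.
  have E1 : E (slope p x z 1) by exists 1 => //; rewrite /= in_itv/= ltr01 lexx.
  have [|_ [tz tzI <-] tzE] := inf_adherent (E := E) e4.
    by split => //; exists (slope p x z 1).
  move: tzI; rewrite /= in_itv/= => /andP[tz0 tz1].
  have tz20 : 0 < tz / 2 by rewrite divr_gt0.
  exists (ball z (e / 4), [set t | t < tz / 2]).
    split; first exact: nbhsx_ballx.
    exact: nbhs_right_lt.
  move=> [w t]/= [+ ttz] Sw t0; rewrite ballEmdist/= => zw.
  have Aw := SA _ Sw.
  have t2z : 2 * t <= tz by lra.
  have t21 : 2 * t <= 1 by lra.
  split => //.
  have t20 : 0 < 2 * t by rewrite mulr_gt0.
  have t1 : t <= 1 by lra.
  have := slope_lip (p := p) Ax Az Aw t20 t21.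
  have := slope_lip (p := p) Ax Az Aw t0 t1.
  rewrite !ler_norml => /andP[_ h1] /andP[h2 _].
  have h3 := slope_monotone Ap Ax Az _ _ t20 t2z tz1.
  have h4 : inf E <= slope p x z t.
    by apply: ge_inf => //; exists t => //; rewrite /= in_itv/= t0.
  lra.
have /compact_near_coveringP/(_ R 0^'+ P) := cS.
move=> /(_ _ near_z)[d /= d0 dP].
exists d => // z t Sz t0 td; apply: (dP t) => //=.
by rewrite sub0r normrN gtr0_norm.
Qed.

(** Near x, distance functions are almost affine along the geodesics that end at
x: the change along the whole geodesic from y to x, up to an error small
compared with its length, bounds the change along each part proportionally. The
lower bound comes from prolonging the geodesic from x through y to twice its
length. *)
Lemma dist_almost_affine {p x r e} : compact A -> A p ->
  (forall w, mdist x w <= r -> A w) -> 0 < r ->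
  locally_geodesically_complete X -> 0 < e ->
  exists2 rho, 0 < rho & forall y, mdist x y < rho -> forall t, 0 <= t <= 1 ->
    `|mdist p (geo A y x t) - mdist p y| <=
      t * (`|mdist p y - mdist p x| + e * mdist x y).
Proof.
move=> cA Ap xA r0 ext e0.
have Ax : A x by apply: xA; rewrite mdistxx ltW.
have er : 0 < e * r / 2 by rewrite divr_gt0// mulr_gt0.
have [t0 t00 ht0] := slope_uniform cA Ap xA r0 er.
exists (Num.min (t0 * r) r) => [|y]; first by rewrite lt_min mulr_gt0.
rewrite lt_min => /andP[ytr yr] t /andP[t_0 t_1].
have t01 : 0 <= t <= 1 by rewrite t_0.
have [xy|xy] := eqVneq x y.
  have := geo_distl hA Ax Ax t01; rewrite xy mdistxx mulr0 => /mdist_positivity <-.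
  by rewrite !subrr normr0 add0r mulr0 mulr0.
have [z [xz xyz]] := geodesic_extension hA cA r0 xA ext y xy (ltW yr).
have Ay : A y by apply: xA; exact: ltW.
have Az : A z by apply: xA; rewrite xz.
have xnz : x != z by rewrite -mdist_gt0 xz.
set T := mdist x y in ytr yr *.
have T0 : 0 < T by rewrite mdist_gt0.
pose tau := T / r.
have tau0 : 0 < tau by rewrite divr_gt0.
have taut0 : tau < t0 by rewrite ltr_pdivrMr.
have [tau21 Hslope] := ht0 _ _ xz tau0 taut0.
have ytau : geo A x z tau = y by rewrite /tau -xz geo_through.
pose E s := mdist p (geo A x z s).
have E0 : E 0 = mdist p x by rewrite /E (geo0 hA).
have Etau : E tau = mdist p y by rewrite /E ytau.
have tau01 : 0 <= tau <= 1 by apply/andP; split; lra.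
have zero01 : 0 <= (0 : R) <= 1 by rewrite lexx ler01.
have geoE : geo A y x t = geo A x z (tau + t * (0 - tau)).
  by rewrite -(geo_geo hA Ax Az tau01 zero01 t01) ytau (geo0 hA).
rewrite geoE -/(E _) -E0 -Etau; set Et := E (tau + _).
have upper : Et <= (1 - t) * E tau + t * E 0.
  exact: dist_geo_conv_param.
(* The parameter tau is a convex combination of (1 - t) tau and 2 tau. *)
have lower : E tau - Et <= t * (E (2 * tau) - E tau).
  have s01 : 0 <= tau + t * (0 - tau) <= 1 by apply/andP; split; nra.
  have u01 : 0 <= 2 * tau <= 1 by apply/andP; split; lra.
  have t10 : 0 < 1 + t by lra.
  have v01 : 0 <= t / (1 + t) <= 1.
    by rewrite divr_ge0 ?(ltW t10)//= ler_pdivrMr// mul1r lerDr ler01.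
  have := dist_geo_conv_param hA Ap Ax Az s01 u01 v01.
  rewrite [X in geo _ _ _ X](_ : _ = tau); last by field; rewrite gt_eqF.
  rewrite -!/(E _) -/Et => h.
  have : (1 + t) * E tau <= (1 + t) *
      ((1 - t / (1 + t)) * Et + t / (1 + t) * E (2 * tau)) by rewrite ler_pM2l.
  rewrite [leRHS](_ : _ = Et + t * E (2 * tau)); first by lra.
  by field; rewrite gt_eqF.
have slopeE s : 0 < s -> s * slope p x z s = E s - E 0.
  by move=> s0; rewrite /slope mulrC mulfVK ?gt_eqF// E0.
have incr : E (2 * tau) - E tau <= E tau - E 0 + e * T.
  have := slopeE _ tau0; have := slopeE (2 * tau); rewrite mulr_gt0// => /(_ isT).
  have -> : e * T = 2 * tau * (e * r / 2) by rewrite /tau; field; rewrite gt_eqF.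
  have : 2 * tau * (slope p x z (2 * tau) - slope p x z tau) <=
    2 * tau * (e * r / 2) by rewrite ler_pM2l// mulr_gt0.
  by lra.
have teT : 0 <= t * (e * T) by rewrite mulr_ge0// ltW// mulr_gt0.
have tincr := ler_wpM2l t_0 incr.
rewrite ler_norml; have [h|h] := lerP 0 (E tau - E 0).
  have th := mulr_ge0 t_0 h; rewrite (ger0_norm h).
  by apply/andP; split; lra.
have th := mulr_ge0_le0 t_0 (ltW h); rewrite (ltr0_norm h).
by apply/andP; split; lra.
Qed.
End infinitesimal_homogeneity.
Arguments slope {R X A} p x z t.

(** * Angles and rates of change *)

Section angles_and_slopes.
Context {R : realType}.

Lemma cos_lip (a b : R) : `|cos a - cos b| <= `|a - b|.
Proof.
wlog ba : a b / b <= a => [sym|].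
  have [/sym//|/ltW ab] := leP b a.
  by rewrite distrC (distrC a); exact: sym.
have [|c _ ->] := @MVT_segment R cos (fun x => - sin x) b a ba _.
  by apply: continuous_subspaceT => x; exact: continuous_cos.
by rewrite normrM normrN ler_piMl// sin_max.
Qed.

(** At the ends of [-1, 1], where acos is not differentiable, continuity comes from
its being the inverse of the decreasing function cos. *)
Lemma cvg_acos {T : Type} {F : set_system T} {FF : ProperFilter F}
    (f : T -> R) (l : R) :
  (\forall x \near F, -1 <= f x <= 1) -> f @ F --> l ->
  -1 <= l <= 1 /\ acos (f x) @[x --> F] --> acos l.
Proof.
move=> f1 fl.
have l1 : -1 <= l <= 1.
  apply/andP; split.
  - by apply: (cvgr_to_ge fl); apply: filterS f1 => x /andP[].
  - by apply: (cvgr_to_le fl); apply: filterS f1 => x /andP[].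
split=> //; apply/cvgrPdist_le => e e0.
have a0 := acos_ge0 l1; have api := acos_lepi l1.
have al : cos (acos l) = l by rewrite acosK// in_itv.
have up : \forall x \near F, acos (f x) <= acos l + e.
  have [le|lt] := leP pi (acos l + e).
    by apply: filterS f1 => x fx; exact: le_trans (acos_lepi fx) le.
  have cl : cos (acos l + e) < l.
    rewrite -[ltRHS]al ltr_cos ?in_itv/= ?a0//; first by rewrite ltrDl.
    by rewrite addr_ge0 ?(ltW e0)//= ltW.
  near=> x; have fx : -1 <= f x <= 1 by near: x.
  have lx : cos (acos l + e) < f x by near: x; exact: (cvgr_gt _ fl _ cl).
  rewrite leNgt; apply/negP => h.
  move: lx; rewrite -[f x]acosK ?in_itv// ltr_cos ?in_itv/= ?acos_ge0 ?acos_lepi//.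
    by rewrite ltNge ltW.
  by rewrite addr_ge0 ?(ltW e0)//= ltW.
have dn : \forall x \near F, acos l - e <= acos (f x).
  have [le|lt] := leP (acos l - e) 0.
    by apply: filterS f1 => x fx; exact: le_trans le (acos_ge0 fx).
  have le : acos l - e <= pi by apply: le_trans api; rewrite gerBl ltW.
  have cl : l < cos (acos l - e).
    by rewrite -[ltLHS]al ltr_cos ?in_itv/= ?a0 ?(ltW lt)// gtrBl.
  near=> x; have fx : -1 <= f x <= 1 by near: x.
  have lx : f x < cos (acos l - e) by near: x; exact: (cvgr_lt _ fl _ cl).
  rewrite leNgt; apply/negP => h.
  move: lx; rewrite -[f x]acosK ?in_itv// ltr_cos ?in_itv/= ?acos_ge0 ?acos_lepi ?(ltW lt)//.
  by rewrite ltNge ltW.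
near=> x; have h1 : acos (f x) <= acos l + e by near: x.
have h2 : acos l - e <= acos (f x) by near: x.
by rewrite ler_norml; apply/andP; split; lra.
Unshelve. all: by end_near. Qed.

Context {X : metricType R} {A : set X} (hA : BNPC A).
Implicit Types (p x y z : X) (s t e m : R).

(** First variation: the cosine of the angle at y is minus the one-sided
derivative of the distance to p along the unit-speed shortest path to z, and that
derivative is the infimum of the difference quotients by convexity. *)
Lemma first_variation {p y z} : A p -> A y ->
  (forall w, mdist y w <= mdist y z -> A w) -> p != y -> y != z ->
  exists m, [/\ 0 <= angle p y z <= pi, cos (angle p y z) = - m,
    forall t, 0 < t -> t <= 1 -> m * mdist y z <= slope (A := A) p y z t &
    forall e s, 0 < e -> 0 < s ->
      exists t, [/\ 0 < t, t < s, t <= 1 &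
        slope (A := A) p y z t < (m + e) * mdist y z]].
Proof.
move=> Ap Ay nearA py yz; have L0 : 0 < mdist y z by rewrite mdist_gt0.
have Az : A z by apply: nearA.
set L := mdist y z in L0 nearA *.
have D00 : 0 < mdist p y by rewrite mdist_gt0.
set D0 := mdist p y in D00 *.
pose D u := mdist p (geo A y z (u / L)).
pose q u := (D u - D0) / u.
have iL u : 0 < u -> u <= L -> 0 < u / L /\ u / L <= 1.
  by move=> u0 uL; rewrite divr_gt0//= ler_pdivrMr// mul1r.
have iL' u : 0 < u -> u <= L -> 0 <= u / L <= 1.
  by move=> u0 uL; have [h ->] := iL u u0 uL; rewrite ltW.
have qE u : 0 < u -> q u = slope (A := A) p y z (u / L) / L.
  by move=> u0; rewrite /slope /q /D -/D0; field; rewrite !gt_eqF.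
pose m := inf [set q u | u in [set` `]0, L]]].
have qlb : has_lbound [set q u | u in [set` `]0, L]]].
  exists (- 1) => _ [u ui <-]; move: ui; rewrite /= in_itv/= => /andP[u0 uL].
  have [h1 h2] := iL u u0 uL.
  by rewrite qE// ler_pdivlMr// mulN1r; exact: slope_ge.
have qm : q u @[u --> 0^'+] --> m.
  apply: nondecreasing_at_right_cvgr => //.
  move=> u v; rewrite !in_itv/= => /andP[u0 uL] /andP[v0 vL] uv.
  rewrite !qE// ler_pM2r ?invr_gt0//.
  have [h1 h2] := iL u u0 uL; have [h3 h4] := iL v v0 vL.
  by apply: (slope_monotone hA) => //; rewrite ler_pM2r ?invr_gt0.
have mq u : 0 < u -> u <= L -> m <= q u.
  move=> u0 uL; apply: ge_inf => //; exists u => //=.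
  by rewrite in_itv/= u0.
(* The cosine of the comparison angle, with the difference quotient singled out. *)
pose c u := u / (2 * D0) - q u * (D u + D0) / (2 * D0).
have near_L : \forall u \near (0 : R)^'+, 0 < u /\ u <= L.
  near=> u; split; near: u; first exact: nbhs_right_gt.
  exact: nbhs_right_le.
have Dlip u : 0 < u -> u <= L -> D0 - u <= D u <= D0 + u.
  move=> u0 uL; have := mdist_lip p (geo A y z (u / L)) y.
  rewrite (metric_sym (geo A y z _)) (geo_distl hA)// ?iL'// -/L -/(D u) -/D0 mulfVK ?gt_eqF//.
  by rewrite ler_norml => /andP[? ?]; apply/andP; split; lra.
have DD0 : D u @[u --> 0^'+] --> D0.
  apply/cvgrPdist_le => e e0; near=> u.
  have [u0 uL] : 0 < u /\ u <= L by near: u.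
  have ue : u <= e by near: u; exact: nbhs_right_le.
  have /andP[h1 h2] := Dlip _ u0 uL.
  by rewrite ler_norml; apply/andP; split; lra.
have u0cvg : u @[u --> (0 : R)^'+] --> (0 : R).
  by apply: cvg_at_right_filter; exact: cvg_id.
have cm : c u @[u --> 0^'+] --> - m.
  rewrite (_ : - m = 0 / (2 * D0) - m * (D0 + D0) / (2 * D0)); last first.
    by field; rewrite gt_eqF.
  apply: cvgB; first by apply: cvgM => //; exact: cvg_cst.
  apply: cvgM; last exact: cvg_cst.
  by apply: cvgM => //; apply: cvgD => //; exact: cvg_cst.
have c1 : \forall u \near (0 : R)^'+, -1 <= c u <= 1.
  near=> u.
  have [u0 uL] : 0 < u /\ u <= L by near: u.
  have uD : u <= D0 by near: u; exact: nbhs_right_le.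
  have /andP[h1 h2] := Dlip _ u0 uL.
  have -> : c u = (D0 ^+ 2 + u ^+ 2 - D u ^+ 2) / (2 * D0 * u).
    by rewrite /c /q; field; rewrite !gt_eqF.
  have Du0 : 0 < 2 * D0 * u by rewrite !mulr_gt0.
  rewrite ler_pdivlMr// ler_pdivrMr//.
  apply/andP; split; nra.
have cE : \forall u \near (0 : R)^'+, acos (c u) = comparison_angle p y (shortest y z u).
  near=> u; have [u0 uL] : 0 < u /\ u <= L by near: u.
  rewrite (shortest_geo hA yz Ay nearA) ?(ltW u0)//.
  rewrite /comparison_angle (geo_distl hA)// ?iL'// -/L mulfVK ?gt_eqF//.
  rewrite -/(D u) -/D0; congr acos.
  by rewrite /c /q; field; rewrite !gt_eqF.
have [m1 am] := cvg_acos _ _ c1 cm.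
have angE : angle p y z = acos (- m).
  apply: cvg_lim => //; apply: cvg_trans am; exact: near_eq_cvg.
exists m; split.
- by rewrite angE acos_ge0//= acos_lepi.
- by rewrite angE acosK// in_itv.
- move=> t t0 t1; have tL0 : 0 < t * L by rewrite mulr_gt0.
  have := mq (t * L) tL0; rewrite ger_pMl// => /(_ t1).
  by rewrite qE// mulfK ?gt_eqF// ler_pdivlMr.
- move=> e s e0 s0.
  have me : m < m + e by rewrite ltrDl.
  have qme := cvgr_lt _ qm _ me.
  near (0 : R)^'+ => u.
  have [u0 uL] : 0 < u /\ u <= L by near: u.
  have us : u < s * L by near: u; apply: nbhs_right_lt; rewrite mulr_gt0.
  have [h1 h2] := iL u u0 uL.
  exists (u / L); split => //; first by rewrite ltr_pdivrMr.
  rewrite -ltr_pdivrMr// -qE//.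
  near: u; exact: qme.
Unshelve. all: by end_near. Qed.

(** The rate at the start is at least 1 - e, and convexity preserves this bound
along the whole geodesic, even where nothing is known about angles. *)
Lemma obtuse_angle_increase {p y z e t} : A p -> A y ->
  (forall w, mdist y w <= mdist y z -> A w) -> p != y -> y != z ->
  pi - e < angle p y z -> 0 <= t <= 1 ->
  mdist p y + (1 - e) * (t * mdist y z) <= mdist p (geo A y z t).
Proof.
move=> Ap Ay nearA py yz big /andP[t0 t1].
have Az : A z by apply: nearA.
have [m [/andP[a0 api] cm ms _]] := first_variation Ap Ay nearA py yz.
have := cos_lip (angle p y z) pi; rewrite cospi cm.
rewrite (ler0_norm (x := _ - pi)) ?subr_le0// => lip.
have := le_trans (ler_norm _) lip => h.
have em : 1 - e <= m by lra.
have [->|tn0] := eqVneq t 0; first by rewrite mul0r mulr0 addr0 (geo0 hA).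
have tp : 0 < t by rewrite lt_neqAle eq_sym tn0.
have := ms t tp t1; rewrite /slope ler_pdivlMr// => h1.
have h2 : (1 - e) * (t * mdist y z) <= m * (t * mdist y z).
  by rewrite ler_wpM2r// mulr_ge0// mdist_ge0.
by rewrite mulrC mulrA -[leLHS]mulrC in h1; lra.
Qed.

Lemma right_angle_decrease {p y z e t} : A p -> A y ->
  (forall w, mdist y w <= mdist y z -> A w) -> p != y -> y != z ->
  `|angle p y z - pi / 2| < e -> 0 <= t <= 1 ->
  mdist p y - e * (t * mdist y z) <= mdist p (geo A y z t).
Proof.
move=> Ap Ay nearA py yz right /andP[t0 t1].
have Az : A z by apply: nearA.
have [m [/andP[a0 api] cm ms _]] := first_variation Ap Ay nearA py yz.
have := cos_lip (angle p y z) (pi / 2); rewrite cos_pihalf cm subr0 normrN => lip.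
have em : - e <= m.
  by have := le_lt_trans lip right; rewrite ltr_norml => /andP[/ltW].
have [->|tn0] := eqVneq t 0; first by rewrite mul0r mulr0 subr0 (geo0 hA).
have tp : 0 < t by rewrite lt_neqAle eq_sym tn0.
have := ms t tp t1; rewrite /slope ler_pdivlMr// => h1.
have h2 : - e * (t * mdist y z) <= m * (t * mdist y z).
  by rewrite ler_wpM2r// mulr_ge0// mdist_ge0.
by lra.
Qed.

(** A right angle bounds the increase only infinitesimally; along a path on which
the angle stays nearly right, the bound propagates because the slope of a convex
function up to a time is at most its slope just after. *)
Lemma right_angle_increase {p y z e t} : A p -> A y ->
  (forall w, mdist y w <= mdist y z -> A w) -> y != z ->
  0 <= t -> t < 1 -> p != geo A y z t ->
  (forall w, mdist (geo A y z t) w <= mdist (geo A y z t) z -> A w) ->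
  `|angle p (geo A y z t) z - pi / 2| < e ->
  mdist p (geo A y z t) <= mdist p y + e * (t * mdist y z).
Proof.
move=> Ap Ay nearA yz t0 t1 pw nearA' right.
have Az : A z by apply: nearA.
have t01 : 0 <= t <= 1 by rewrite t0 ltW.
set w := geo A y z t in pw nearA' right *.
have Aw : A w by apply: (geoA hA).
have L0 : 0 < mdist y z by rewrite mdist_gt0.
have wzE : mdist w z = (1 - t) * mdist y z by rewrite (geo_distr hA).
have wz : w != z by rewrite -mdist_gt0 wzE mulr_gt0// subr_gt0.
have [m [/andP[a0 api] cm _ ms]] := first_variation Ap Aw nearA' pw wz.
have := cos_lip (angle p w z) (pi / 2); rewrite cos_pihalf cm subr0 normrN => lip.
have em : 0 < e - m.
  by have := le_lt_trans lip right; rewrite ltr_norml subr_gt0 => /andP[].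
have [s [s0 _ s1]] := ms _ 1 em ltr01.
rewrite addrC subrK {1}/slope ltr_pdivrMr// wzE.
have one01 : 0 <= (1 : R) <= 1 by rewrite lexx ler01.
have s01 : 0 <= s <= 1 by rewrite ltW.
have zE : z = geo A y z 1 by rewrite (geo1 hA).
rewrite {1}zE (geo_geo hA)//.
set u := t + s * (1 - t) => h.
have u01 : 0 <= u <= 1 by rewrite /u; apply/andP; split; nra.
have tu : t <= u by rewrite /u lerDl mulr_ge0// ?subr_ge0 ltW.
have u0 : 0 < u by rewrite /u; nra.
have tu01 : 0 <= t / u <= 1 by rewrite divr_ge0 ?(ltW u0)//= ler_pdivrMr// mul1r.
have zero01 : 0 <= (0 : R) <= 1 by rewrite lexx ler01.
have := dist_geo_conv_param hA Ap Ay Az zero01 u01 tu01.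
rewrite subr0 add0r mulfVK ?gt_eqF// (geo0 hA)// -/w => cvx.
have : u * mdist p w <= u * ((1 - t / u) * mdist p y + t / u * mdist p (geo A y z u)).
  by rewrite ler_pM2l.
rewrite [leRHS](_ : _ = (u - t) * mdist p y + t * mdist p (geo A y z u)); last first.
  by field; rewrite gt_eqF.
have h' : t * (mdist p (geo A y z u) - mdist p w) <=
    t * (e * ((1 - t) * mdist y z) * s) by rewrite ler_wpM2l// ltW.
have utE : u - t = s * (1 - t) by rewrite /u; ring.
have ut0 : 0 < u - t by rewrite utE mulr_gt0// subr_gt0.
move=> k; rewrite -(ler_pM2l ut0).
have -> : (u - t) * (mdist p y + e * (t * mdist y z)) =
   (u - t) * mdist p y + t * (e * ((1 - t) * mdist y z) * s) by rewrite utE; ring.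
by lra.
Qed.

End angles_and_slopes.

(** * Motions along a strainer *)

Section moves_along_strainers.
Context {R : realType} {X : metricType R}.
Implicit Types (A B U : set X) (b c p x y z : X) (s t e delta rho : R).

(** All the conditions that an inductively defined strainer imposes on its i-th
point: an opposite point, and almost right angles with the preceding points only,
whence a triangular structure. *)
Lemma strainerS_point {B delta x j} {ps : 'I_j.+1 -> X} :
  strainerS B delta x ps -> forall i, exists pbar U,
    [/\ B (ps i), B pbar, nbhs x U & U `<=` B] /\
    [/\ forall l : 'I_j.+1, (l <= i)%N -> ~ U (ps l), ~ U pbar,
        forall y, U y -> pi - delta < angle (ps i) y pbar &
        forall y (l : 'I_j.+1), U y -> (l < i)%N ->
          `|angle (ps l) y (ps i) - pi / 2| < delta /\
          `|angle (ps l) y pbar - pi / 2| < delta].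
Proof.
elim: j ps => [ps /= [Bp [pbar [Bpbar [U [xU UB Up Upbar Uang]]]]] i|j IH ps].
  rewrite (ord1 i); exists pbar, U; do 2 split => //.
  by move=> l _; rewrite (ord1 l).
move=> /= [/IH prev [Bp _] [pbar [U [[Bpbar [U' [xU' _ _ _ opp]]] xU UB]]]].
move=> [Ups Upbar] right i.
have wid (l : 'I_j.+2) : (l < j.+1)%N ->
    exists l' : 'I_j.+1, l = widen_ord (leqnSn j.+1) l'.
  by move=> lj; exists (Ordinal lj); apply: val_inj.
have [ij|ji] := ltnP i j.+1.
  have [i' iE] := wid _ ij.
  have [qbar [V [[Bi Bq xV VB] [Vp Vq ang rt]]]] := prev i'.
  exists qbar, V; rewrite iE; do 2 split => //.
  - move=> l li; have [l' lE] := wid l (leq_ltn_trans li (ltn_ord i')).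
    by rewrite lE; apply: Vp; move: li; rewrite lE.
  - move=> y l Vy li; have [l' lE] := wid l (ltn_trans li (ltn_ord i')).
    by rewrite lE; apply: rt => //; move: li; rewrite lE.
have -> : i = ord_max by apply: val_inj; apply/eqP; rewrite eqn_leq -ltnS ltn_ord.
exists pbar, (U `&` U'); split.
  by split => //; [exact: filterI|move=> y [/UB]].
split.
- by move=> l _ [/Ups].
- by move=> [/Upbar].
- by move=> y [_ /opp].
- by move=> y l [Uy _] lj; have [l' ->] := wid _ lj; exact: right.
Qed.

Definition toward A b y s := geo A y b (s / mdist y b).

Section toward.
Context {A : set X} (hA : BNPC A).

Lemma toward0 {b y} : A b -> A y -> toward A b y 0 = y.
Proof. by move=> Ab Ay; rewrite /toward mul0r (geo0 hA). Qed.

Lemma toward_param {b y s} : 0 <= s -> s <= mdist y b ->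
  0 <= s / mdist y b <= 1.
Proof.
move=> s0 sb; have [->|b0] := eqVneq (mdist y b) 0.
  by rewrite invr0 mulr0 lexx ler01.
by rewrite divr_ge0 ?mdist_ge0//= ler_pdivrMr ?mul1r// lt_neqAle eq_sym b0 mdist_ge0.
Qed.

Lemma toward_dist {b y s} : A b -> A y -> 0 <= s -> s <= mdist y b ->
  mdist y (toward A b y s) = s.
Proof.
move=> Ab Ay s0 sb; rewrite /toward (geo_distl hA)//; last exact: toward_param.
have [b0|b0] := eqVneq (mdist y b) 0; last by rewrite mulfVK.
by rewrite b0 mulr0; move: sb; rewrite b0 => sb; apply/eqP; rewrite eq_le s0.
Qed.

Lemma cvg_toward {T : Type} {F : set_system T} {FF : Filter F}
    {Y : T -> X} {S : T -> R} {b y s} :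
  A b -> A y -> y != b -> 0 <= s -> s <= mdist y b ->
  Y @ F --> y -> S @ F --> s ->
  (\forall u \near F, [/\ A (Y u), 0 <= S u & S u <= mdist (Y u) b]) ->
  toward A b (Y u) (S u) @[u --> F] --> toward A b y s.
Proof.
move=> Ab Ay yb s0 sb Yy Ss nearA.
have dY : mdist (Y u) b @[u --> F] --> mdist y b.
  by rewrite metric_sym; under eq_fun do rewrite metric_sym; exact: cvg_mdist.
apply: (cvg_geo hA) => //; first exact: toward_param.
  by apply: cvgM => //; apply: cvgV => //; rewrite gt_eqF// mdist_gt0.
near=> u; have [AY S0 Sb] : [/\ A (Y u), 0 <= S u & S u <= mdist (Y u) b].
  by near: u.
by split => //; exact: toward_param.
Unshelve. all: by end_near. Qed.

End toward.

Definition joint_cvg {Y Z W : topologicalType} (m : Y -> Z -> W)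
    (y : Y) (z : Z) :=
  m u.1 u.2 @[u --> (y, z)] --> m y z.

(** A move changes the value of f i by a prescribed amount s, up to a relative
error delta, disturbs the preceding coordinates by at most delta |s|, and those
that follow in an uncontrolled way. *)
Definition has_moves {K : nat} (f : 'I_K -> X -> R) delta x :=
  forall i, exists rho (m : X -> R -> X), 0 < rho /\
    forall y s, mdist x y < rho -> `|s| < rho ->
    [/\ mdist y (m y s) <= `|s|,
        `|f i (m y s) - (f i y + s)| <= delta * `|s|,
        forall l : 'I_K, (l < i)%N -> `|f l (m y s) - f l y| <= delta * `|s| &
        joint_cvg m y s].

Lemma nbhs_mdist {x U} : nbhs x U ->
  exists2 rho, 0 < rho & forall w, mdist x w < rho -> U w.
Proof.
move=> /nbhs_ballP[rho /= rho0 xU]; exists rho => // w xw.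
by apply: xU; rewrite ballEmdist.
Qed.

(** To lower the distance to a strainer point, go toward it; to raise it, go
toward the opposite point. *)
Lemma strainer_moves {B delta x j} {ps : 'I_j.+1 -> X} :
  tiny_ball B -> 0 < delta -> strainerS B delta x ps ->
  has_moves (fun i => mdist (ps i)) delta x.
Proof.
move=> [c [r [r0 -> _ hA]]] d0 str i.
set B' := ball c r in str.
set A := [set y | _] in hA.
have [pbar [U [[Bi Bq xU UB] [Up Uq ang right]]]] := strainerS_point str i.
have [rho3 rho30 HU] := nbhs_mdist xU.
pose rho := rho3 / 3.
have rho0 : 0 < rho by rewrite divr_gt0.
have rho3E : rho3 = 3 * rho by rewrite /rho; field.
have BA y : B' y -> A y.
  by rewrite /B' ballEmdist /A/= => cy; lra.
have nearA y z : B' y -> B' z -> forall w, mdist y w <= mdist y z -> A w.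
  rewrite /B' ballEmdist /A/= => cy cz w yw.
  have := metric_triangle c y w; have := metric_triangle y c z.
  by rewrite (metric_sym y c); lra.
have far b : ~ U b -> forall y, mdist x y < 2 * rho -> rho < mdist y b.
  move=> Ub y xy; rewrite ltNge; apply/negP => yb; apply: Ub; apply: HU.
  by apply: le_lt_trans (metric_triangle _ y _) _; lra.
have Bps l : B' (ps l) by have [? [? [[]]]] := strainerS_point str l.
have UA y : U y -> A y by move=> /UB/BA.
set p := ps i in Bi ang right.
have Ap := BA _ Bi; have Aq := BA _ Bq.
have pU : ~ U p by apply: Up.
have neU b y : ~ U b -> U y -> b != y.
  by move=> Ub Uy; apply/eqP => bE; apply: Ub; rewrite bE.
have maxE s : Num.max 0 s = (s + `|s|) / 2.
  by case: (leP 0 s) => s0; rewrite ?(ger0_norm s0) ?(ltr0_norm s0); lra.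
pose down y s := toward A p y (Num.max 0 (- s)).
(* At most one of the two motions is nontrivial; composing them instead of
   distinguishing the sign of s makes continuity at s = 0 immediate. *)
pose m y s := toward A pbar (down y s) (Num.max 0 s).
have max0 s : 0 <= Num.max 0 s by rewrite le_max lexx.
have downP y s : mdist x y < rho -> `|s| < rho ->
    [/\ U y, U (down y s),
        Num.max 0 s <= mdist (down y s) pbar, Num.max 0 s < mdist y pbar &
        Num.max 0 (- s) < mdist y p].
  move=> xy srho.
  have xy2 : mdist x y < 2 * rho by lra.
  have Uy : U y by apply: HU; lra.
  have mx1 : Num.max 0 (- s) <= `|s| by rewrite ge_max normr_ge0 -normrN ler_norm.
  have mx2 : Num.max 0 s <= `|s| by rewrite ge_max normr_ge0 ler_norm.
  have yp := far _ pU _ xy2; have yq := far _ Uq _ xy2.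
  have h1 : Num.max 0 (- s) <= mdist y p by lra.
  have dd := toward_dist hA Ap (UA _ Uy) (max0 _) h1.
  have xd : mdist x (down y s) < 2 * rho.
    by apply: le_lt_trans (metric_triangle _ y _) _; rewrite /down dd; lra.
  have dq := far _ Uq _ xd.
  by split => //; [apply: HU; lra|lra|lra|lra].
exists rho, m; split => // y s xy srho.
have [Uy Ud h2 h3 h4] := downP y s xy srho.
have Ay := UA _ Uy; have Ad := UA _ Ud.
have h1 := ltW h4.
have cont : joint_cvg m y s.
  rewrite /joint_cvg /m.
  have fstc : u.1 @[u --> (y, s)] --> y by exact: cvg_fst.
  have sndc : u.2 @[u --> (y, s)] --> s by exact: cvg_snd.
  have nearu : \forall u \near (y, s), mdist x u.1 < rho /\ `|u.2| < rho.
    near=> u; split; near: u.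
      exact: (cvgr_lt _ (cvg_mdist _ x y fstc) _ xy).
    exact: (cvgr_lt _ (cvg_norm sndc) _ srho).
  have maxc g : g u @[u --> (y, s)] --> s ->
      Num.max 0 (g u) @[u --> (y, s)] --> Num.max 0 s.
    move=> gs; rewrite maxE; under eq_fun do rewrite maxE.
    by apply: cvgM; [apply: cvgD => //; exact: cvg_norm|exact: cvg_cst].
  have maxcN g : g u @[u --> (y, s)] --> s ->
      Num.max 0 (- g u) @[u --> (y, s)] --> Num.max 0 (- s).
    move=> gs; rewrite maxE; under eq_fun do rewrite maxE.
    apply: cvgM; last exact: cvg_cst.
    by apply: cvgD; [exact: cvgN|apply: cvg_norm; exact: cvgN].
  have downc : down u.1 u.2 @[u --> (y, s)] --> down y s.
    apply: (cvg_toward hA) => //.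
    - by rewrite eq_sym; exact: neU.
    - exact: maxcN.
    - near=> u; have [xu su] : mdist x u.1 < rho /\ `|u.2| < rho by near: u.
      by have [/UA AY _ _ _ /ltW] := downP _ _ xu su.
  apply: (cvg_toward hA) => //.
  - by rewrite eq_sym; exact: neU.
  - exact: maxc.
  - near=> u; have [xu su] : mdist x u.1 < rho /\ `|u.2| < rho by near: u.
    by have [_ /UA AY SY] := downP _ _ xu su.
have side b (l : 'I_j.+1) t : B' b -> ~ U b -> U (toward A b y t) ->
    0 <= t -> t < mdist y b ->
    (forall w, U w -> `|angle (ps l) w b - pi / 2| < delta) ->
    ~ U (ps l) -> `|mdist (ps l) (toward A b y t) - mdist (ps l) y| <= delta * t.
  move=> Bb Ub Uw t0 tb rt Ul.
  have tbE : t / mdist y b * mdist y b = t.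
    by rewrite mulfVK// gt_eqF// (le_lt_trans t0).
  have t01 := toward_param t0 (ltW tb).
  have yb : y != b by rewrite eq_sym; exact: neU.
  have Al := BA _ (Bps l).
  have := right_angle_decrease hA Al Ay (nearA _ _ (UB _ Uy) Bb) (neU _ _ Ul Uy) yb
    (rt _ Uy) t01.
  have t1 : t / mdist y b < 1 by rewrite ltr_pdivrMr ?mul1r// (le_lt_trans t0).
  have /andP[t0' _] := t01.
  have := right_angle_increase hA Al Ay (nearA _ _ (UB _ Uy) Bb) yb t0' t1
    (neU _ _ Ul Uw) (nearA _ _ (UB _ Uw) Bb) (rt _ Uw).
  rewrite tbE -/(toward A b y t) => g1 g2.
  by rewrite ler_norml; apply/andP; split; lra.
have [s0|s0] := leP 0 s.
- have smax : Num.max 0 s = s by rewrite max_r.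
  have mE : m y s = toward A pbar y s.
    by rewrite /m /down (max_l (y := - s)) ?oppr_le0// (toward0 hA)// smax.
  have dE : down y s = y by rewrite /down max_l ?oppr_le0// (toward0 hA).
  rewrite smax dE in h2 h3.
  rewrite (ger0_norm s0) mE.
  have dist_s := toward_dist hA Aq Ay s0 h2.
  have Uw : U (toward A pbar y s).
    apply: HU; apply: le_lt_trans (metric_triangle _ y _) _.
    by rewrite dist_s; move: srho; rewrite (ger0_norm s0); lra.
  split => //; last first.
  - by move=> l li; apply: side => //; [move=> w Uw'; have [] := right w l Uw' li|
      apply: Up; exact: ltnW].
  - have sE : s / mdist y pbar * mdist y pbar = s.
      by rewrite mulfVK// gt_eqF// (le_lt_trans s0).
    have yq : y != pbar by rewrite eq_sym; exact: neU.
    have := obtuse_angle_increase hA Ap Ay (nearA _ _ (UB _ Uy) Bq) (neU _ _ pU Uy)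
      yq (ang _ Uy) (toward_param s0 h2).
    rewrite sE -/(toward A pbar y s) => g1.
    have := mdist_lip p (toward A pbar y s) y.
    rewrite (metric_sym (toward _ _ _ _)) dist_s ler_norml => /andP[_ g2].
    have ds : 0 <= delta * s by rewrite mulr_ge0// ltW.
    by rewrite ler_norml; apply/andP; split; lra.
  - by rewrite dist_s.
- have smax : Num.max 0 (- s) = - s by rewrite max_r// oppr_ge0 ltW.
  have mE : m y s = toward A p y (- s).
    rewrite /m (max_l (ltW s0)) (toward0 hA)// /down smax//.
  have s0' : 0 <= - s by rewrite oppr_ge0 ltW.
  rewrite smax in h1 h4.
  rewrite (ltr0_norm s0) mE.
  have dist_s := toward_dist hA Ap Ay s0' h1.
  split => //.
  - by rewrite dist_s.
  - rewrite (metric_sym p) /toward (geo_distr hA)//; last exact: toward_param.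
    rewrite mulrBl mul1r mulfVK; last by rewrite gt_eqF// (le_lt_trans s0').
    rewrite opprK (metric_sym p) subrr normr0 mulr_ge0// ltW//.
  - move=> l li; apply: side => //.
    + by move: Ud; rewrite /down smax.
    + by move=> w Uw'; have [] := right w l Uw' li.
    + by apply: Up; exact: ltnW.
Unshelve. all: by end_near. Qed.

End moves_along_strainers.

(** * Prescribing the values of the strainer map *)

Section solving_by_iterated_moves.
Context {R : realType} {X : metricType R}.
Implicit Types (A : set X) (x y z : X) (s t e c rho C delta : R).

Lemma joint_cvg_comp {T : Type} {F : set_system T} {FF : Filter F}
    {Y Z W : topologicalType} {m : Y -> Z -> W} {f : T -> Y} {g : T -> Z}
    {y : Y} {z : Z} :
  joint_cvg m y z -> f @ F --> y -> g @ F --> z ->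
  m (f u) (g u) @[u --> F] --> m y z.
Proof.
move=> mc fy gz.
exact: (cvg_comp (fun u => (f u, g u)) (fun w => m w.1 w.2) (cvg_pair fy gz) mc).
Qed.

Lemma half_pow_gt0 n : 0 < (1 / 2 : R) ^+ n.
Proof. by rewrite exprn_gt0. Qed.

Lemma half_pow_cvg c : c * (1 / 2) ^+ n @[n --> \oo] --> (0 : R).
Proof.
rewrite -(mulr0 c); apply: cvgM; first exact: cvg_cst.
by apply: cvg_expr; rewrite ger0_norm//; lra.
Qed.

Lemma le_half_pow_eq0 (a : R) c : (forall n, `|a| <= c * (1 / 2) ^+ n) -> a = 0.
Proof.
move=> h; apply/eqP; rewrite -normr_le0.
by apply: (cvgr_to_ge (half_pow_cvg c)); near=> n.
Unshelve. all: by end_near. Qed.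

(** The explicit rate makes limits of iterates depend continuously on parameters. *)
Lemma geometric_limit {A c} {u : nat -> X} : complete_set A ->
  (forall n, A (u n)) ->
  (forall n, mdist (u n) (u n.+1) <= c * (1 / 2) ^+ n) ->
  exists l, forall n, mdist (u n) l <= 2 * c * (1 / 2) ^+ n.
Proof.
move=> cA uA step.
have c0 : 0 <= c by have := step 0%N; rewrite expr0 mulr1; exact: le_trans (mdist_ge0 _ _).
have tail n k : mdist (u n) (u (n + k)%N) <=
    2 * c * (1 / 2) ^+ n - 2 * c * (1 / 2) ^+ (n + k).
  elim: k => [|k IH]; first by rewrite addn0 mdistxx subrr.
  apply: le_trans (metric_triangle _ (u (n + k)%N) _) _.
  have := step (n + k)%N; rewrite addnS exprS.
  by move: IH; set P := _ ^+ n; set Q := _ ^+ (n + k); lra.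
have tail' n k : (n <= k)%N -> mdist (u n) (u k) <= 2 * c * (1 / 2) ^+ n.
  move=> nk; rewrite -(subnKC nk); apply: le_trans (tail _ _) _.
  by rewrite gerBl mulr_ge0 ?mulr_ge0 ?(ltW (half_pow_gt0 _)).
have cu : cauchy (u @ \oo).
  apply/cauchy_ballP => e e0.
  have e20 : 0 < e / 2 by rewrite divr_gt0.
  have [N _ HN] := cvgr_lt _ (half_pow_cvg (2 * c)) _ e20.
  have NN := HN N (leqnn N).
  exists (u @` [set n | (N <= n)%N], u @` [set n | (N <= n)%N]).
    by split; exists N => // n /= Nn; exists n.
  move=> [a b]/= [[i Ni <-] [j Nj <-]].
  rewrite ballEmdist/=.
  apply: le_lt_trans (metric_triangle _ (u N) _) _.
  have := tail' _ _ Ni; have := tail' _ _ Nj; rewrite (metric_sym (u i)) => h1 h2.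
  move: NN => /=; lra.
have [l Al ul] := cA (u @ \oo) _ (filterS (fun _ _ => uA _) filterT) cu.
exists l => n; apply: (cvgr_to_le (cvg_mdist _ (u n) l ul)).
by exists n => // k /= nk; exact: tail'.
Qed.

Section correction.
Context {K : nat} (p : 'I_K -> X) (A : set X) (cA : complete_set A) (x : X).
Implicit Types (v : 'rV[R]_K).

Definition in_range rho y v :=
  mdist x y < rho /\ forall l, `|v 0 l - mdist (p l) x| < rho.

(** A correction of the first k coordinates moves y to a point where they have
the values prescribed by v, at a cost proportional to the largest discrepancy; in
particular it leaves the points that already have these values in place. *)
Definition correction k C rho (Phi : X -> 'rV[R]_K -> X) :=
  forall y v, in_range rho y v ->
  [/\ forall e, 0 <= e -> (forall l : 'I_K, (l < k)%N -> `|v 0 l - mdist (p l) y| <= e) ->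
        mdist y (Phi y v) <= C * e,
      forall l : 'I_K, (l < k)%N -> mdist (p l) (Phi y v) = v 0 l &
      joint_cvg Phi y v].

Lemma in_rangeW {rho rho' y v} : rho <= rho' ->
  in_range rho y v -> in_range rho' y v.
Proof.
by move=> rr [h1 h2]; split=> [|l]; [exact: lt_le_trans rr|exact: lt_le_trans rr].
Qed.

Lemma in_range_gap {rho y v l} : in_range rho y v ->
  `|v 0 l - mdist (p l) y| <= 2 * rho.
Proof.
move=> [xy /(_ l) vl]; have := mdist_lip (p l) x y.
move: vl; rewrite !ler_norml ltr_norml => /andP[? ?] /andP[? ?].
by apply/andP; split; lra.
Qed.

Lemma cvg_coord {y : X} {v} l :
  (fun w : X * 'rV[R]_K => w.2 0 l) @ (y, v) --> v 0 l.
Proof.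
have sv : (@snd X 'rV[R]_K) w @[w --> (y, v)] --> v by exact: cvg_snd.
by apply: (cvg_comp _ (fun w : 'rV[R]_K => w 0 l) sv); exact: coord_continuous.
Qed.

Lemma near_in_range {rho y v} : in_range rho y v ->
  \forall w \near (y, v), in_range rho w.1 w.2.
Proof.
move=> [xy xv].
have y1 : mdist x w.1 @[w --> (y, v)] --> mdist x y.
  by apply: cvg_mdist; exact: cvg_fst.
pose dv l (w : X * 'rV[R]_K) := `|w.2 0 l - mdist (p l) x|.
have v2 l : dv l @ (y, v) --> dv l (y, v).
  apply: cvg_norm; apply: cvgB; last exact: cvg_cst.
  exact: cvg_coord.
have xv' : \forall w \near (y, v), forall l, dv l w < rho.
  exact: (filter_forall _ (fun l => cvgr_lt _ (v2 l) _ (xv l))).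
near=> w; split; near: w; last exact: xv'.
exact: (cvgr_lt _ y1 _ xy).
Unshelve. all: by end_near. Qed.

(** To control one more coordinate, move along its own direction and restore the
preceding ones by the correction at hand. As the move hardly disturbs them, the
restoration is short, and hence hardly disturbs the new coordinate: the
discrepancy decays geometrically and the iterates converge, uniformly. *)
Lemma correction_step {k C rho delta Phi} (kK : (k < K)%N) {m : X -> R -> X} :
  0 <= C -> 0 < delta -> delta * (1 + C) <= 1 / 2 -> 0 < rho ->
  (forall w, mdist x w < rho -> A w) ->
  (forall y s, mdist x y < rho -> `|s| < rho ->
    [/\ mdist y (m y s) <= `|s|,
        `|mdist (p (Ordinal kK)) (m y s) - (mdist (p (Ordinal kK)) y + s)|
          <= delta * `|s|,
        forall l : 'I_K, (l < k)%N ->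
          `|mdist (p l) (m y s) - mdist (p l) y| <= delta * `|s| &
        joint_cvg m y s]) ->
  correction k C rho Phi ->
  exists rho' Phi', 0 < rho' /\ correction k.+1 (4 * C + 3) rho' Phi'.
Proof.
move=> C0 d0 dC rho0 xA mP PhiP.
pose i := Ordinal kK.
pose gap y v := v 0 i - mdist (p i) y.
pose u y v := fix u n := if n is n'.+1
  then Phi (m (u n') (gap (u n') v)) v else Phi y v.
pose e0 y v := `|gap (Phi y v) v|.
(* All iterates and intermediate points are within (9 + 10 C) rho' of x. *)
pose rho' := rho / (10 * (1 + C)).
have C1 : 0 < 1 + C by lra.
have rho'0 : 0 < rho' by rewrite divr_gt0// mulr_gt0.
have rhoE : rho = 10 * (1 + C) * rho' by rewrite /rho'; field; rewrite gt_eqF.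
have Crho : 0 <= C * rho' by rewrite mulr_ge0// ltW.
have rho'rho : rho' <= rho by rewrite rhoE; lra.
have e0_bound y v : in_range rho' y v -> e0 y v <= 2 * (1 + C) * rho'.
  move=> yv; have [dist _ _] := PhiP y v (in_rangeW rho'rho yv).
  have r20 : 0 <= 2 * rho' by lra.
  have d := dist (2 * rho') r20 (fun l _ => in_range_gap yv).
  have := in_range_gap (l := i) yv; have := mdist_lip (p i) y (Phi y v).
  by rewrite /e0 /gap !ler_norml => /andP[? ?] /andP[? ?]; apply/andP; split; lra.
(* One round: its domain, its length and the remaining discrepancy. *)
have inv y v : in_range rho' y v -> forall n,
    [/\ mdist (Phi y v) (u y v n) <= 3 * e0 y v * (1 - (1 / 2) ^+ n),
        `|gap (u y v n) v| <= e0 y v * (1 / 2) ^+ n,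
        mdist (u y v n) (u y v n.+1) <= 3 / 2 * e0 y v * (1 / 2) ^+ n &
        forall l : 'I_K, (l < k)%N -> mdist (p l) (u y v n) = v 0 l] /\
    [/\ in_range rho (u y v n) v, `|gap (u y v n) v| < rho &
        in_range rho (m (u y v n) (gap (u y v n) v)) v].
  move=> yv; have bound := e0_bound y v yv.
  have [dist solve _] := PhiP y v (in_rangeW rho'rho yv).
  have e00 : 0 <= e0 y v by exact: normr_ge0.
  have r20 : 0 <= 2 * rho' by lra.
  have d := dist (2 * rho') r20 (fun l _ => in_range_gap yv).
  have [xy xv] := yv.
  have xv' l : `|v 0 l - mdist (p l) x| < rho by exact: lt_le_trans rho'rho.
  (* The range conditions follow from the two estimates they are based on. *)
  have range z n : mdist (Phi y v) z <= 3 * e0 y v * (1 - (1 / 2) ^+ n) ->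
      `|gap z v| <= e0 y v * (1 / 2) ^+ n ->
      [/\ in_range rho z v, `|gap z v| < rho &
          in_range rho (m z (gap z v)) v].
    move=> dz gz; have hp := half_pow_gt0 n.
    have h1 : (1 / 2 : R) ^+ n <= 1 by apply: exprn_ile1; lra.
    have g2 : `|gap z v| <= 2 * (1 + C) * rho'.
      by apply: le_trans gz _; apply: le_trans bound; rewrite ler_piMr.
    have d2 : mdist (Phi y v) z <= 6 * (1 + C) * rho'.
      apply: le_trans dz _; apply: (@le_trans _ _ (3 * e0 y v)).
        by rewrite ler_piMr ?mulr_ge0//; lra.
      by lra.
    have grho : `|gap z v| < rho by rewrite rhoE; lra.
    have xz : mdist x z <= mdist x y + mdist y (Phi y v) + mdist (Phi y v) z.
      apply: le_trans (metric_triangle _ (Phi y v) _) _.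
      by rewrite lerD2r metric_triangle.
    have xz' : mdist x z < rho by rewrite rhoE; lra.
    have [mz _ _ _] := mP z (gap z v) xz' grho.
    split => //; split => //.
    by apply: le_lt_trans (metric_triangle _ z _) _; rewrite rhoE; lra.
  (* A round moves by at most (1 + C delta) |gap| and leaves a gap of at most
     (delta + C delta) |gap|. *)
  have round z n : mdist (Phi y v) z <= 3 * e0 y v * (1 - (1 / 2) ^+ n) ->
      `|gap z v| <= e0 y v * (1 / 2) ^+ n ->
      (forall l : 'I_K, (l < k)%N -> mdist (p l) z = v 0 l) ->
      let z' := Phi (m z (gap z v)) v in
      [/\ mdist z z' <= 3 / 2 * e0 y v * (1 / 2) ^+ n,
          `|gap z' v| <= e0 y v * (1 / 2) ^+ n.+1 &
          forall l : 'I_K, (l < k)%N -> mdist (p l) z' = v 0 l].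
    move=> dz gz sz z'; have [[xz _] grho rm] := range z n dz gz.
    have [mz mi ml _] := mP z (gap z v) xz grho.
    have [dist' solve' _] := PhiP _ _ rm.
    have dg : 0 <= delta * `|gap z v| by rewrite mulr_ge0// ltW.
    have d' : mdist (m z (gap z v)) z' <= C * (delta * `|gap z v|).
      apply: dist' => // l lk.
      by rewrite -(sz l lk) distrC; exact: ml.
    have Cd : delta * (1 + C) * `|gap z v| <= 1 / 2 * `|gap z v|.
      by rewrite ler_wpM2r.
    split => //.
    - apply: le_trans (metric_triangle _ (m z (gap z v)) _) _.
      have : C * (delta * `|gap z v|) <= 1 / 2 * `|gap z v| by lra.
      by lra.
    - rewrite exprS; have := mdist_lip (p i) (m z (gap z v)) z'.
      move: mi; rewrite -/i [X in _ - (X)](_ : _ = v 0 i); last by rewrite {1}/gap; ring.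
      have z'E : gap z' v = v 0 i - mdist (p i) z' by [].
      rewrite z'E !ler_norml => /andP[? ?] /andP[? ?].
      by apply/andP; split; lra.
  have base0 : mdist (Phi y v) (Phi y v) <= 3 * e0 y v * (1 - (1 / 2) ^+ 0).
    by rewrite mdistxx expr0 subrr mulr0.
  have gap0 : `|gap (Phi y v) v| <= e0 y v * (1 / 2) ^+ 0.
    by rewrite expr0 mulr1.
  suff main n : [/\ mdist (Phi y v) (u y v n) <= 3 * e0 y v * (1 - (1 / 2) ^+ n),
        `|gap (u y v n) v| <= e0 y v * (1 / 2) ^+ n &
        forall l : 'I_K, (l < k)%N -> mdist (p l) (u y v n) = v 0 l].
    move=> n; have [h1 h2 h3] := main n.
    by have [h4 _ _] := round _ _ h1 h2 h3; split; [split|exact: range h1 h2].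
  elim: n => [|n [h1 h2 h3]]; first by split.
  have [h4 h5 h6] := round _ _ h1 h2 h3; split => //.
  apply: le_trans (metric_triangle _ (u y v n) _) _.
  by rewrite exprS; lra.
pose lim_at y v l := forall n, mdist (u y v n) l <= 2 * (3 / 2 * e0 y v) * (1 / 2) ^+ n.
pose Phi' y v := xget y [set l | lim_at y v l].
have Phi'P y v : in_range rho' y v -> lim_at y v (Phi' y v).
  move=> yv; have H := inv y v yv.
  have uA n : A (u y v n) by have [_ [[/xA]]] := H n.
  have ustep n : mdist (u y v n) (u y v n.+1) <= 3 / 2 * e0 y v * (1 / 2) ^+ n.
    by have [[]] := H n.
  have [l ul] := geometric_limit cA uA ustep.
  rewrite /Phi'; case: xgetP => [l' -> //|noway].
  by case: (noway l).
exists rho', Phi'; split => // y v yv.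
have lP := Phi'P y v yv.
have [dist solve cont] := PhiP y v (in_rangeW rho'rho yv).
split.
- move=> e e_ge0 ve.
  have dPhi : mdist y (Phi y v) <= C * e.
    by apply: dist => // l lk; apply: ve; exact: ltnW.
  have e0e : e0 y v <= (1 + C) * e.
    have := ve i (leqnn _); have := mdist_lip (p i) y (Phi y v).
    by rewrite /e0 /gap !ler_norml => /andP[? ?] /andP[? ?]; apply/andP; split; lra.
  have := lP 0%N; rewrite expr0 mulr1 /= => h.
  by apply: le_trans (metric_triangle _ (Phi y v) _) _; lra.
- move=> l lk1; apply/eqP; rewrite -subr_eq0; apply/eqP.
  apply: (@le_half_pow_eq0 _ (4 * e0 y v)) => n.
  have [[_ g _ solved] _] := inv y v yv n.
  have := lP n; have := mdist_lip (p l) (Phi' y v) (u y v n).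
  rewrite (metric_sym (Phi' y v)) => h1 h2.
  have e00 : 0 <= e0 y v * (1 / 2) ^+ n.
    by apply: mulr_ge0; [exact: normr_ge0|exact: ltW (half_pow_gt0 n)].
  move: lk1; rewrite ltnS leq_eqVlt => /orP[/eqP lk|lk].
    have lE : l = i by apply: val_inj.
    move: g h1; rewrite lE /gap !ler_norml => /andP[? ?] /andP[? ?].
    by apply/andP; split; lra.
  move: h1; rewrite (solved _ lk) => h1.
  by apply: le_trans h1 _; apply: le_trans h2 _; lra.
- have ucont n : u w.1 w.2 n @[w --> (y, v)] --> u y v n.
    elim: n => [|n IH] /=; first exact: cont.
    have [_ [[xun _] grho rm]] := inv y v yv n.
    have [_ _ contm] := PhiP _ _ rm.
    apply: (joint_cvg_comp contm); last exact: cvg_snd.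
    have gapc : gap (u w.1 w.2 n) w.2 @[w --> (y, v)] --> gap (u y v n) v.
      apply: cvgB; last exact: cvg_mdist.
      exact: cvg_coord.
    have [_ _ _ mc] := mP _ _ xun grho.
    exact: (joint_cvg_comp mc).
  apply/metricType_numDomainType.cvgrPdist_lt => e e_gt0.
  pose c := 6 * (1 + C) * rho'.
  have e30 : 0 < e / 3 by rewrite divr_gt0.
  have [n _ Hn] := cvgr_lt _ (half_pow_cvg c) _ e30.
  have {Hn} Hn := Hn n (leqnn n).
  near=> w.
  have wr : in_range rho' w.1 w.2 by near: w; exact: near_in_range.
  have h1 := lP n; have h2 := Phi'P _ _ wr n.
  have h3 : mdist (u y v n) (u w.1 w.2 n) < e / 3.
    by near: w; exact: metricType_numDomainType.cvgr_dist_lt (ucont n) _ e30.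
  have hp := half_pow_gt0 n.
  have := e0_bound _ _ yv; have := e0_bound _ _ wr => b1 b2.
  apply: le_lt_trans (metric_triangle _ (u y v n) _) _.
  have := metric_triangle (u y v n) (u w.1 w.2 n) (Phi' w.1 w.2).
  rewrite (metric_sym (Phi' y v)).
  have b3 : 2 * (3 / 2 * e0 y v) * (1 / 2) ^+ n <= c * (1 / 2) ^+ n.
    by rewrite ler_pM2r// /c; lra.
  have b4 : 2 * (3 / 2 * e0 w.1 w.2) * (1 / 2) ^+ n <= c * (1 / 2) ^+ n.
    by rewrite ler_pM2r// /c; lra.
  move: Hn => /= Hn; lra.
Unshelve. all: by end_near. Qed.

End correction.
End solving_by_iterated_moves.

(** * Fibred neighbourhoods *)

Section retractions_onto_fibres.
Context {R : realType}.

(** If V carries a jointly continuous map that moves every point of V within V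
to the fibre over any prescribed value, leaving it in place when it is there
already, then homotopies are lifted pointwise by that map, and a contraction of V
pushed to a fibre contracts the fibre. *)
Lemma fibration_of_retractions {T S : topologicalType} {f : T -> S} {V : set T}
    {Phi : T -> S -> T} : contractible R V ->
  {within V, continuous f} ->
  (forall y v, V y -> (f @` V) v ->
    [/\ V (Phi y v), f (Phi y v) = v & joint_cvg Phi y v]) ->
  (forall y, V y -> Phi y (f y) = y) ->
  hurewicz_fibration R f V (f @` V) /\
  forall v, (f @` V) v -> contractible R (V `&` f @^-1` [set v]).
Proof.
move=> [a [H [Va Hc HV H0 H1]]] fc PhiP Phi_id; split.
  split => // Z K h Kc KV hc hV hK.
  exists (fun w => Phi (h w.1) (K w)); split.
  - apply/subspace_continuousP => -[z t] /= [_ t01].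
    have [_ _ Pc] := PhiP (h z) (K (z, t)) (hV z) (KV z t t01).
    apply: (joint_cvg_comp Pc).
      apply: (cvg_comp _ h _ (hc z)); apply: cvg_trans (cvg_app _ (@cvg_within _ _ _ _)) _.
      exact: cvg_fst.
    by move/subspace_continuousP: Kc; apply.
  - by move=> z t t01; have [] := PhiP (h z) (K (z, t)) (hV z) (KV z t t01).
  - by move=> z /=; rewrite -hK Phi_id.
  - by move=> z t t01; have [] := PhiP (h z) (K (z, t)) (hV z) (KV z t t01).
move=> v fVv; exists (Phi a v), (fun w => Phi (H w) v).
have HV' z t : V z -> t \in `[0, 1] -> V (H (z, t)).
  by move=> Vz t01; apply: HV => //; rewrite inE.
split.
- by have [] := PhiP a v Va fVv.
- apply/subspace_continuousP => -[z t] /= [[Vz fz] t01].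
  have [_ _ Pc] := PhiP _ _ (HV' _ _ Vz t01) fVv.
  apply: (joint_cvg_comp Pc); last exact: cvg_cst.
  move/subspace_continuousP: Hc => /(_ (z, t) (conj Vz t01)) Hzt B /Hzt.
  rewrite /= !nbhs_simpl /= /within /= => HB.
  by apply: filterS HB => w HB [[Vw _] tw]; exact: HB.
- move=> z t; rewrite inE => -[Vz fz] t01.
  by have [] := PhiP _ _ (HV' _ _ Vz t01) fVv.
- move=> z; rewrite inE => -[Vz fz] /=.
  by rewrite H0 ?inE// -fz Phi_id.
- by move=> z; rewrite inE => -[Vz fz] /=; rewrite H1 ?inE.
Qed.

End retractions_onto_fibres.

Section fibred_neighbourhood.
Context {R : realType} {X : metricType R}.
Implicit Types (A : set X) (x y z : X) (s t e c rho C delta : R).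

Lemma common_radius {K : nat} {x} {P : 'I_K -> X -> Prop} :
  (forall l, exists2 rho, 0 < rho & forall y, mdist x y < rho -> P l y) ->
  exists2 rho, 0 < rho & forall y, mdist x y < rho -> forall l, P l y.
Proof.
move=> H; have near_x : \forall y \near x, forall l, P l y.
  have nearl l : \forall y \near x, P l y.
    have [rho rho0 Hl] := H l; apply/nbhs_ballP; exists rho => //= y.
    by rewrite ballEmdist; exact: Hl.
  exact: (filter_forall _ nearl).
by have [rho rho0 Hrho] := nbhs_mdist near_x; exists rho.
Qed.

Lemma cvg_rV {T : Type} {F : set_system T} {FF : Filter F} {K : nat}
    {g : T -> 'rV[R]_K} {v : 'rV[R]_K} :
  (forall l, g u 0 l @[u --> F] --> v 0 l) -> g @ F --> v.
Proof.
move=> gl B [P vP PB].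
have nearP : \forall u \near F, forall l, P 0 l (g u 0 l).
  exact: (filter_forall _ (fun l => gl l _ (vP 0 l))).
by apply: filterS nearP => u gP; apply: PB => i j; rewrite (ord1 i).
Qed.

(** One more coordinate turns the cost C into 4 C + 3, whence 4^k - 1. *)
Lemma corrections {K : nat} {p : 'I_K -> X} {A x rho0 delta} :
  complete_set A -> 0 < rho0 -> (forall w, mdist x w < rho0 -> A w) ->
  0 < delta -> delta * 4 ^+ K <= 1 / 2 ->
  has_moves (fun l => mdist (p l)) delta x ->
  forall k, (k <= K)%N -> exists rho Phi,
    0 < rho /\ correction p x k (4 ^+ k - 1) rho Phi.
Proof.
move=> cA rho00 xA d0 dK mP; elim=> [|k IH] kK.
  exists 1, (fun y _ => y); split => // y v _; split => //.
  - by move=> e _ _; rewrite mdistxx expr0 subrr mul0r.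
  - exact: cvg_fst.
have [rho [Phi [rho0' PhiP]]] := IH (ltnW kK).
have [rho1 [m [rho10 Hm]]] := mP (Ordinal kK).
pose r := Num.min rho (Num.min rho1 rho0).
have r0 : 0 < r by rewrite !lt_min rho0' rho10.
have r_rho : r <= rho by rewrite ge_min lexx.
have r_rho1 : r <= rho1 by rewrite !ge_min lexx orbT.
have r_rho0 : r <= rho0 by rewrite !ge_min lexx !orbT.
have pow1 : 1 <= 4 ^+ k :> R by apply: exprn_ege1; lra.
have powK : 4 ^+ k <= 4 ^+ K :> R by apply: ler_weXn2l; [lra|exact: ltnW].
have -> : 4 ^+ k.+1 - 1 = 4 * (4 ^+ k - 1) + 3 :> R by rewrite exprS; ring.
apply: (correction_step p A cA x kK (delta := delta) (m := m) (Phi := Phi) (rho := r)) => //.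
- by rewrite subr_ge0.
- rewrite addrC subrK; apply: le_trans dK.
  by rewrite ler_pM2l.
- by move=> w xw; apply: xA; exact: lt_le_trans r_rho0.
- by move=> y s xy sr; apply: Hm; exact: lt_le_trans r_rho1.
- by move=> y v yv; apply: PhiP; exact: in_rangeW r_rho yv.
Qed.

Lemma cvg_dist_row {T : Type} {F : set_system T} {FF : Filter F} {K : nat}
    {p : 'I_K -> X} {Y : T -> X} {y : X} : Y @ F --> y ->
  (\row_l mdist (p l) (Y u) : 'rV[R]_K) @[u --> F] --> (\row_l mdist (p l) y).
Proof.
move=> Yy; apply: cvg_rV => l; rewrite mxE.
by under eq_fun do rewrite mxE; exact: cvg_mdist.
Qed.

(** The neighbourhood is cut out of a ball of radius r about x by a much smaller
bound eta on the variation of f. Going toward x along geodesics changes f by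
little, as distance functions are almost affine there; restoring f costs little,
so that the corrected motion still decreases the distance to x near the boundary
of the ball. This makes room for the correction toward nearby fibres and
contracts the neighbourhood to x. *)
Lemma fibred_neighbourhood {K : nat} {p : 'I_K -> X} {A : set X} {x r0 C rho Phi} :
  BNPC A -> compact A -> 0 < r0 -> (forall w, mdist x w <= r0 -> A w) ->
  (forall l, A (p l)) -> locally_geodesically_complete X ->
  0 < rho -> correction p x K C rho Phi ->
  let f := fun y => \row_l mdist (p l) y : 'rV[R]_K in
  forall W : set X, nbhs x W -> exists V : set X,
    [/\ open V, V x, V `<=` W, contractible R V &
        hurewicz_fibration R f V (f @` V) /\
        forall v, (f @` V) v -> contractible R (V `&` f @^-1` [set v])].
Proof.
move=> hA cA r00 xA Ap ext rho0 PhiP f W xW.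
pose D := Num.max C 1.
have CD : C <= D by rewrite le_max lexx.
have D1 : 1 <= D by rewrite le_max lexx orbT.
have D0 : 0 < D := lt_le_trans ltr01 D1.
(* Correcting the nonaffine part of f over a length T then costs T / 4. *)
pose eps := (4 * D)^-1.
have eps0 : 0 < eps by rewrite invr_gt0 mulr_gt0.
have DepsE : D * eps = 1 / 4 by rewrite /eps; field; rewrite gt_eqF.
pose affine_at l y := forall t, 0 <= t <= 1 ->
  `|mdist (p l) (geo A y x t) - mdist (p l) y| <=
    t * (`|mdist (p l) y - mdist (p l) x| + eps * mdist x y).
have [rho1 rho10 affine] := common_radius (P := affine_at) (fun l =>
  dist_almost_affine hA cA (Ap l) xA r00 ext eps0).
have [rhoW rhoW0 HW] := nbhs_mdist xW.
pose r := Num.min (Num.min rho rho1) (Num.min r0 rhoW).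
have r_gt0 : 0 < r by rewrite !lt_min rho0 rho10 r00.
have r_rho : r <= rho by rewrite !ge_min lexx.
have r_rho1 : r <= rho1 by rewrite !ge_min lexx orbT.
have r_r0 : r <= r0 by rewrite !ge_min lexx !orbT.
have r_rhoW : r <= rhoW by rewrite !ge_min lexx !orbT.
pose N : R := K.+1%:R.
have N1 : 1 <= N by rewrite ler1n.
have N0 : 0 < N := lt_le_trans ltr01 N1.
(* Corrections between values in the range of V are much shorter than r. *)
pose eta := r / (32 * D * N).
have eta0 : 0 < eta by rewrite divr_gt0// !mulr_gt0.
have DetaN : D * eta * N = r / 32.
  by rewrite /eta; field; rewrite !gt_eqF.
have Deta : D * eta <= r / 32.
  by rewrite -DetaN ler_peMr// mulr_ge0// ltW.
have eta_r : eta < rho.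
  have : eta <= D * eta by rewrite ler_peMl// ltW.
  lra.
have Ax : A x by apply: xA; rewrite mdistxx ltW.
pose V := [set y | mdist x y < r /\ forall l, `|mdist (p l) y - mdist (p l) x| < eta].
have VA y : V y -> A y by move=> [xy _]; apply: xA; rewrite ltW// (lt_le_trans xy).
have fE y l : f y 0 l = mdist (p l) y by rewrite mxE.
have fc (T : Type) (F : set_system T) (FF : Filter F) (Y : T -> X) y :
    Y @ F --> y -> f (Y u) @[u --> F] --> f y by exact: cvg_dist_row.
have id_on_fibre y : in_range p x rho y (f y) -> Phi y (f y) = y.
  move=> yr; have [/(_ 0 (lexx 0)) dist _ _] := PhiP y (f y) yr.
  apply/esym/mdist_positivity/eqP; rewrite eq_le mdist_ge0 andbT -(mulr0 C).
  by apply: dist => l _; rewrite fE subrr normr0.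
(* The time t spent toward x must pay for the correction by s: beyond r / 2 from x
   it gains more than t r / 4, and up to r / 2 there is room for all costs. *)
have push y t (v : 'rV[R]_K) s : V y -> 0 <= t <= 1 ->
    (forall l, `|v 0 l - mdist (p l) x| < eta) -> 0 <= s ->
    (forall l, `|v 0 l - mdist (p l) y| <= s) -> D * s <= t * r / 4 ->
    [/\ in_range p x rho (geo A y x t) v, V (Phi (geo A y x t) v) &
        f (Phi (geo A y x t) v) = v].
  move=> Vy t01 vx s0 vy Ds; have Ay := VA y Vy; have [xy yx] := Vy.
  have /andP[t0 t1] := t01.
  set g := geo A y x t; set T := mdist x y in xy.
  have T0 : 0 <= T := mdist_ge0 _ _.
  have xg : mdist x g = (1 - t) * T.
    by rewrite metric_sym (geo_distr hA)// (metric_sym y).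
  have gr : in_range p x rho g v.
    split=> [|l]; last exact: lt_trans eta_r.
    by rewrite xg; apply: le_lt_trans (lt_le_trans xy r_rho); rewrite ler_piMl//; lra.
  have [dist solve _] := PhiP g v gr.
  have solved : f (Phi g v) = v by apply/rowP => l; rewrite fE solve.
  split => //; split; last by move=> l; rewrite -fE solved.
  pose e := s + t * (eta + eps * T).
  have epsT0 : 0 <= eps * T by rewrite mulr_ge0// ltW.
  have e0 : 0 <= e by rewrite addr_ge0// mulr_ge0// addr_ge0// ltW.
  have ve l : `|v 0 l - mdist (p l) g| <= e.
    have := affine y (lt_le_trans xy r_rho1) l t t01; rewrite -/g -/T => h.
    have h' : t * (`|mdist (p l) y - mdist (p l) x| + eps * T) <= t * (eta + eps * T).
      by rewrite ler_wpM2l// lerD2r ltW.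
    have := vy l; move: (le_trans h h'); rewrite /e !ler_norml.
    by move=> /andP[? ?] /andP[? ?]; apply/andP; split; lra.
  have gq : mdist g (Phi g v) <= D * e.
    by apply: le_trans (dist e e0 (fun l _ => ve l)) _; rewrite ler_wpM2r.
  apply: le_lt_trans (metric_triangle _ g _) _; rewrite xg.
  have De : D * e = D * s + t * (D * eta) + t * T / 4.
    rewrite /e; have -> : t * T / 4 = t * (D * eps) * T by rewrite DepsE; ring.
    by ring.
  have tDeta : t * (D * eta) <= t * (r / 32) by rewrite ler_wpM2l.
  have tT : 0 <= t * T by rewrite mulr_ge0.
  have tr : 0 <= t * r by rewrite mulr_ge0// ltW.
  have tr1 : t * r <= r by rewrite ler_piMl// ltW.
  have [rT|Tr] := leP (r / 2) T; last by lra.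
  have trT : t * (r / 2) <= t * T by rewrite ler_wpM2l.
  by lra.
have push_cvg (T : Type) (F : set_system T) (FF : Filter F) (Y : T -> X)
    (S : T -> R) (v' : T -> 'rV[R]_K) y t v :
    Y @ F --> y -> S @ F --> t -> v' @ F --> v -> A y -> 0 <= t <= 1 ->
    in_range p x rho (geo A y x t) v ->
    (\forall u \near F, A (Y u) /\ 0 <= S u <= 1) ->
    Phi (geo A (Y u) x (S u)) (v' u) @[u --> F] --> Phi (geo A y x t) v.
  move=> Yy St vv Ay t01 gr near01; have [_ _ Pc] := PhiP _ _ gr.
  by apply: (joint_cvg_comp Pc) => //; exact: (cvg_geo hA).
have Vx : V x.
  by rewrite /V/= mdistxx; split => // l; rewrite subrr normr0.
have near_V y : V y -> \forall w \near y, V w.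
  move=> [xy yx].
  have nearl : \forall w \near y, forall l, `|mdist (p l) w - mdist (p l) x| < eta.
    apply: (filter_forall _ _) => l.
    have c : `|mdist (p l) w - mdist (p l) x| @[w --> y] -->
        `|mdist (p l) y - mdist (p l) x|.
      by apply: cvg_norm; apply: cvgB; [exact: continuous_mdist|exact: cvg_cst].
    exact: (cvgr_lt _ c _ (yx l)).
  near=> w; split; near: w; last exact: nearl.
  exact: (cvgr_lt _ (continuous_mdist x y) _ xy).
have contrV : contractible R V.
  pose v' (w : X * R) := (1 - w.2) *: f w.1 + w.2 *: f x.
  have v'E y t l : v' (y, t) 0 l = (1 - t) * mdist (p l) y + t * mdist (p l) x.
    by rewrite !mxE.
  have main y t : V y -> 0 <= t <= 1 ->
      [/\ in_range p x rho (geo A y x t) (v' (y, t)),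
          V (Phi (geo A y x t) (v' (y, t))) &
          f (Phi (geo A y x t) (v' (y, t))) = v' (y, t)].
    move=> Vy t01; have [_ yx] := Vy; have /andP[t0 t1] := t01.
    have t10 : 0 <= 1 - t by rewrite subr_ge0.
    apply: (push y t _ (t * eta)) => //.
    - move=> l; rewrite v'E [X in `|X|](_ : _ =
        (1 - t) * (mdist (p l) y - mdist (p l) x)); last by ring.
      rewrite normrM (ger0_norm t10); apply: le_lt_trans (yx l).
      by rewrite ler_piMl// gerBl.
    - by rewrite mulr_ge0// ltW.
    - move=> l; rewrite v'E [X in `|X|](_ : _ =
        - (t * (mdist (p l) y - mdist (p l) x))); last by ring.
      by rewrite normrN normrM (ger0_norm t0) ler_wpM2l// ltW.
    - have : t * (D * eta) <= t * (r / 32) by rewrite ler_wpM2l.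
      have : 0 <= t * r by rewrite mulr_ge0// ltW.
      by lra.
  exists x, (fun w => Phi (geo A w.1 x w.2) (v' w)); split => //.
  - apply/subspace_continuousP => -[y t] /= [Vy]; rewrite in_itv/= => t01.
    have [gr _ _] := main y t Vy t01.
    set F := within _ _.
    have fstF : u.1 @[u --> F] --> y.
      by apply: cvg_trans (cvg_app _ (@cvg_within _ _ _ _)) _; exact: cvg_fst.
    have sndF : u.2 @[u --> F] --> t.
      by apply: cvg_trans (cvg_app _ (@cvg_within _ _ _ _)) _; exact: cvg_snd.
    apply: push_cvg => //.
    + apply: cvgD; apply: cvgZ => //; last exact: cvg_cst.
        by apply: cvgB => //; exact: cvg_cst.
      exact: fc.
    + exact: VA.
    + rewrite /F; near=> w; have [/= /VA Aw wt] : (V `*` `[0, 1]%classic) w.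
        by near: w; exact: withinT.
      by move: wt; rewrite in_itv/=.
  - move=> y t; rewrite inE in_itv/= => Vy t01.
    by have [] := main y t Vy t01.
  - move=> y; rewrite inE => Vy; have := main y 0 Vy; rewrite lexx ler01 => /(_ isT).
    rewrite /= /v' /= subr0 scale1r scale0r addr0 (geo0 hA (VA y Vy) Ax) => -[gr _ _].
    exact: id_on_fibre.
  - move=> y; rewrite inE => Vy; have := main y 1 Vy; rewrite lexx ler01 => /(_ isT).
    rewrite /= /v' /= subrr scale1r scale0r add0r (geo1 hA (VA y Vy) Ax) => -[gr _ _].
    exact: id_on_fibre.
(* A sum instead of a maximum, because continuity is then immediate; this is what
   the factor N in eta pays for. *)
pose gap y (v : 'rV[R]_K) : R := \sum_l `|v 0 l - mdist (p l) y|.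
have gap0 y v : 0 <= gap y v by exact: sumr_ge0.
have le_gap y (v : 'rV[R]_K) l : `|v 0 l - mdist (p l) y| <= gap y v.
  by rewrite /gap (bigD1 l)//= lerDl sumr_ge0.
(* The least time that pays for the correction; it vanishes with the gap. *)
pose tau y (v : 'rV[R]_K) := 4 * D * gap y v / r.
have tau0 y v : 0 <= tau y v.
  by rewrite /tau mulr_ge0 ?invr_ge0 ?(ltW r_gt0)// mulr_ge0// mulr_ge0// ltW.
have tau_lt1 y v : V y -> (f @` V) v -> tau y v < 1.
  move=> [_ yx] [z [_ zx] <-]; rewrite /tau ltr_pdivrMr// mul1r.
  have gapN : gap y (f z) <= 2 * eta * N.
    have -> : N = K%:R + 1 by rewrite /N -natr1.
    rewrite mulrDr mulr1.
    apply: (@le_trans _ _ (\sum_(l < K) 2 * eta)); last first.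
      by rewrite sumr_const card_ord -[leLHS]mulr_natr lerDl mulr_ge0// ltW.
    apply: ler_sum => l _; rewrite fE; have := zx l; have := yx l.
    rewrite !ltr_norml ler_norml => /andP[? ?] /andP[? ?].
    by apply/andP; split; lra.
  have : D * gap y (f z) <= D * (2 * eta * N) by rewrite ler_pM2l.
  by lra.
have tau_cvg y v : tau w.1 w.2 @[w --> (y, v)] --> tau y v.
  apply: cvgM; last exact: cvg_cst.
  apply: cvgM; first exact: cvg_cst.
  apply: cvg_big => [|l _]; first exact: add_continuous.
  apply: cvg_norm; apply: cvgB; first exact: cvg_coord.
  by apply: cvg_mdist; exact: cvg_fst.
exists V; split => //.
- by rewrite openE => y Vy; exact: near_V.
- by move=> y [xy _]; apply: HW; exact: lt_le_trans r_rhoW.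
pose Phi' y v := Phi (geo A y x (tau y v)) v.
apply: (fibration_of_retractions (Phi := Phi')) => //.
- by apply/subspace_continuousP => y _; apply: fc; exact: cvg_within.
- move=> y v Vy fv; have t1 := tau_lt1 y v Vy fv.
  have t01 : 0 <= tau y v <= 1 by rewrite tau0 ltW.
  have vx l : `|v 0 l - mdist (p l) x| < eta.
    by have [z [_ zx] <-] := fv; rewrite fE.
  have Ds : D * gap y v <= tau y v * r / 4.
    by rewrite /tau mulfVK ?gt_eqF//; lra.
  have [gr Vq fq] := push y (tau y v) v (gap y v) Vy t01 vx (gap0 y v) (le_gap y v) Ds.
  split => //; rewrite /joint_cvg /Phi'; apply: push_cvg => //.
  + exact: cvg_fst.
  + exact: tau_cvg.
  + exact: cvg_snd.
  + exact: VA.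
  + near=> w; have /VA Aw : V w.1.
      by near: w; exact: (cvg_fst (near_V y Vy)).
    split => //; rewrite tau0 ltW//.
    by near: w; exact: (cvgr_lt _ (tau_cvg y v) _ t1).
- move=> y Vy; rewrite /Phi' [tau _ _](_ : _ = 0); last first.
    rewrite /tau /gap big1 ?mulr0 ?mul0r// => l _.
    by rewrite fE subrr normr0.
  rewrite (geo0 hA (VA y Vy) Ax); apply: id_on_fibre.
  have [xy yx] := Vy; split; first exact: lt_le_trans r_rho.
  by move=> l; rewrite fE; exact: lt_trans eta_r.
Unshelve. all: by end_near. Qed.

End fibred_neighbourhood.

Theorem theorem5p11 (R : realType) (k : nat) (hk : (1 <= k)%N) :
  exists2 delta_k : R, 0 < delta_k &
    forall (X : metricType R) (x : X) (delta : R) (f : X -> 'rV[R]_k),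
      GNPC X -> 0 < delta -> delta < delta_k -> strainer_map delta x f ->
      forall W : set X, nbhs x W ->
        exists V : set X,
          [/\ open V, V x, V `<=` W, contractible R V &
              hurewicz_fibration R f V (f @` V) /\
              forall y, (f @` V) y -> contractible R (V `&` f @^-1` [set y])].
Proof.
exists (1 / (2 * 4 ^+ k)).
  by rewrite divr_gt0// mulr_gt0// exprn_gt0.
move=> X x delta f [_ _ ext _] d0 dk [B [ps [tinyB Bx str ->]]] W xW.
case: k hk f ps str dk => // j _ f ps /= str dk.
have moves := strainer_moves tinyB d0 str.
have [c [r [r0 BE cA hA]]] := tinyB.
set A := [set y | _] in cA hA.
have cB y : B y -> mdist c y < r by rewrite BE ballEmdist.
have xA w : mdist x w <= r -> A w.
  by move=> xw; have := metric_triangle c x w; have := cB x Bx; rewrite /A/=; lra.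
have psA l : A (ps l).
  have [? [? [[/cB psl _ _ _] _]]] := strainerS_point str l.
  by rewrite /A/=; lra.
have dpow : delta * 4 ^+ j.+1 <= 1 / 2.
  move: dk; rewrite ltr_pdivlMr; last by rewrite mulr_gt0// exprn_gt0.
  by set P := 4 ^+ _; lra.
have [cplA _ _] := hA.
have [rho [Phi [rho0 PhiP]]] :=
  corrections cplA r0 (fun w xw => xA w (ltW xw)) d0 dpow moves _ (leqnn _).
exact: (fibred_neighbourhood hA cA r0 xA psA ext rho0 PhiP).
Qed.
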